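(* Let $\mathbb{F}$ be a field, let $P$ be a finite distributive lattice of dimension $n$, with $n\ge 1$, and let $F\colon P\to\mathsf{Vec}_{\mathbb{F}}$ be a finitely generated persistence module. Then the following are equivalent. (1) $F$ has projective dimension at most $n-1$. (2) $F$ is cross-degree $n-1$. (3) $F\cong\Gamma^{n-1}F$.
   Context: Notation: $[k]=\{0,\dots,k\}$; $\mathcal{P}(S)$ is the power set of $S$ ordered by inclusion. A lattice $P$ is distributive if $x\wedge(y\vee z)=(x\wedge y)\vee(x\wedge z)$ for all $x,y,z$. Posets are viewed as categories. A persistence module is a functor $F\colon P\to\mathsf{Vec}_{\mathbb{F}}$ from a poset $P$ to vector spaces over $\mathbb{F}$. These form the abelian category $\mathrm{Fun}(P,\mathsf{Vec}_{\mathbb{F}})$, which has enough projectives. $F$ is finitely generated if it is a quotient of a finite direct sum of modules $\mathbb{F}[x,-)$, where $\mathbb{F}[x,-)$ is $\mathbb{F}$ on $\{y: y\ge x\}$ (with identity maps) and $0$ elsewhere; for finite $P$ this means that all $F(x)$ are finite-dimensional. An object $A$ has projective dimension at most $m$ if it admits a projective resolution $0\to Q_m\to\dots\to Q_0\to A\to 0$. The dimension (order dimension, Dushnik–Miller dimension) of a poset $P$ is the minimal number of total orders such that $P$ embeds, via an order embedding ($x\le y\iff i(x)\le i(y)$), into their product with the product order. Meet-dimension: $v\in P$ is meet-irreducible if $v\ne x\wedge y$ for all $x,y>v$. Put $\mathrm{mdim}(v)=0$ if $v$ is maximal in $P$; otherwise $\mathrm{mdim}(v)$ is the least $k$ such that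 $v$ is a meet of $k$ meet-irreducible elements. $P^{\le k}=\{v\in P:\mathrm{mdim}(v)\le k\}$. $T^kF$ is the right Kan extension of $F|_{P^{\le k}}$ along $P^{\le k}\hookrightarrow P$, i.e. $T^kF(x)=\lim_{v\in P^{\le k},\,v\ge x}F(v)$, with canonical natural transformation $\eta_k\colon F\to T^kF$. Define $\Gamma^kF=\mathrm{im}(\eta_k\colon F\to T^kF)$. A $k$-cube in a category $\mathscr{C}$ is a functor $\mathcal{X}\colon\mathcal{P}([k-1])\to\mathscr{C}$. A cube is strongly bicartesian if each face of dimension at least 2 is both cartesian and cocartesian; for a cube $\mathcal{X}$ in a lattice this means $\mathcal{X}(S\cup T)=\mathcal{X}(S)\vee\mathcal{X}(T)$ and $\mathcal{X}(S\cap T)=\mathcal{X}(S)\wedge\mathcal{X}(T)$ for all $S,T$. The total fiber of a $1$-cube of vector spaces is $\mathrm{tfib}(\mathcal{X})=\ker(\mathcal{X}(\emptyset)\to\mathcal{X}(\{0\}))$, and for a $k$-cube with $k>1$ it is the kernel of the induced map from the total fiber of the $(k-1)$-cube $S\mapsto\mathcal{X}(S)$ to that of $S\mapsto\mathcal{X}(S\cup\{k-1\})$ ($S\subseteq[k-2]$). $F$ is cross-degree $k$ if $\mathrm{tfib}(F\circ\mathcal{X})\cong0$ for every strongly bicartesian $(k+1)$-cube $\mathcal{X}\colon\mathcal{P}([k])\to P$. *)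

(* Defs.v *)
From HB Require Import structures.
From mathcomp Require Import all_boot all_order all_algebra.
From mathcomp Require Import boolp.

Set Implicit Arguments.
Unset Strict Implicit.
Unset Printing Implicit Defensive.

Import Order.TTheory GRing.Theory.
(* {set T} is ordered by inclusion. *)
Import Order.DefaultSetSubsetOrder.

Local Open Scope ring_scope.

Section LinearAlgebra.
Variable K : fieldType.

Definition mklin (U V : lmodType K) (f : U -> V) (fP : linear f) :
  {linear U -> V} := HB.pack f (GRing.isLinear.Build K U V *:%R f fP).

Section DependentProduct.
Variables (I : Type) (V : I -> lmodType K).

Definition dprod : Type := forall i, V i.

HB.instance Definition _ := gen_eqMixin dprod.
HB.instance Definition _ := gen_choiceMixin dprod.

Definition dprod_zero : dprod := fun=> 0.
Definition dprod_opp (s : dprod) : dprod := fun i => - s i.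
Definition dprod_add (s t : dprod) : dprod := fun i => s i + t i.
Definition dprod_scale (a : K) (s : dprod) : dprod := fun i => a *: s i.

Lemma dprod_addA : associative dprod_add.
Proof. by move=> s t u; apply: functional_extensionality_dep => i; apply: addrA. Qed.
Lemma dprod_addC : commutative dprod_add.
Proof. by move=> s t; apply: functional_extensionality_dep => i; apply: addrC. Qed.
Lemma dprod_add0 : left_id dprod_zero dprod_add.
Proof. by move=> s; apply: functional_extensionality_dep => i; apply: add0r. Qed.
Lemma dprod_addN : left_inverse dprod_zero dprod_opp dprod_add.
Proof. by move=> s; apply: functional_extensionality_dep => i; apply: addNr. Qed.

HB.instance Definition _ :=
  GRing.isZmodule.Build dprod dprod_addA dprod_addC dprod_add0 dprod_addN.

Lemma dprod_scaleA (a b : K) (s : dprod) :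
  dprod_scale a (dprod_scale b s) = dprod_scale (a * b) s.
Proof. by apply: functional_extensionality_dep => i; apply: scalerA. Qed.
Lemma dprod_scale1 : left_id 1 dprod_scale.
Proof. by move=> s; apply: functional_extensionality_dep => i; apply: scale1r. Qed.
Lemma dprod_scaleDr : right_distributive dprod_scale +%R.
Proof. by move=> a s t; apply: functional_extensionality_dep => i; apply: scalerDr. Qed.
Lemma dprod_scaleDl (s : dprod) : {morph dprod_scale^~ s : a b / a + b}.
Proof. by move=> a b; apply: functional_extensionality_dep => i; apply: scalerDl. Qed.

HB.instance Definition _ := GRing.Zmodule_isLmodule.Build K dprod
  dprod_scaleA dprod_scale1 dprod_scaleDr dprod_scaleDl.

End DependentProduct.

Definition dprod_map (I : Type) (V W : I -> lmodType K)
  (f : forall i, {linear V i -> W i}) : {linear dprod V -> dprod W}.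
Proof.
apply: (@mklin (dprod V) (dprod W) (fun s i => f i (s i))) => a s t.
by apply: functional_extensionality_dep => i; apply: linearP.
Defined.

Definition dprod_reindex (I J : Type) (V : I -> lmodType K) (g : J -> I) :
  {linear dprod V -> dprod (fun j => V (g j))}.
Proof.
by apply: (@mklin (dprod V) (dprod (fun j => V (g j)))
  (fun s j => s (g j))) => a s t.
Defined.

Definition dprod_tuple (I : Type) (U : lmodType K) (V : I -> lmodType K)
  (f : forall i, {linear U -> V i}) : {linear U -> dprod V}.
Proof.
apply: (@mklin U (dprod V) (fun u i => f i u)) => a s t.
by apply: functional_extensionality_dep => i; apply: linearP.
Defined.

Record subspace (V : lmodType K) := Subspace {
  in_subspace :> V -> Prop;
  subspace0 : in_subspace 0;
  subspaceP : forall (a : K) (u v : V),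
    in_subspace u -> in_subspace v -> in_subspace (a *: u + v) }.

Section SubspaceModule.
Variables (V : lmodType K) (S : subspace V).

Record subsp := Subsp { subsp_val : V; _ : `[< S subsp_val >] }.

HB.instance Definition _ := [isSub for subsp_val].
HB.instance Definition _ := [Choice of subsp by <:].

Lemma subsp_closed : submod_closed [pred v | `[< S v >]].
Proof.
split=> [|a u v]; first by rewrite inE; apply/asboolP; apply: subspace0.
by rewrite !inE => /asboolP Su /asboolP Sv; apply/asboolP; apply: subspaceP.
Qed.

HB.instance Definition _ := GRing.SubChoice_isSubLmodule.Build
  K V [pred v | `[< S v >]] subsp subsp_closed.

Lemma subsp_valP (s : subsp) : S (val s).
Proof. by case: s => v /= /asboolP. Qed.

Definition to_subsp (v : V) (Sv : S v) : subsp := Subsp (asboolT Sv).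

End SubspaceModule.

Section SubspaceMaps.
Variables (U V : lmodType K) (f : {linear U -> V}).

Definition kernel : subspace U.
Proof.
apply: (@Subspace _ (fun u => f u = 0)); first exact: raddf0.
by move=> a u v fu fv; rewrite linearP fu fv scaler0 addr0.
Defined.

Definition image : subspace V.
Proof.
apply: (@Subspace _ (fun v => exists u, f u = v)).
  by exists 0; apply: raddf0.
by move=> a _ _ [u <-] [v <-]; exists (a *: u + v); rewrite linearP.
Defined.

Variables (S : subspace U) (T : subspace V).

Definition corestrict (fT : forall u, T (f u)) : {linear U -> subsp T}.
Proof.
apply: (@mklin _ _ (fun u => to_subsp (fT u))) => a u v.
by apply: val_inj; apply: linearP.
Defined.

Definition subsp_map (fST : forall u, S u -> T (f u)) :
  {linear subsp S -> subsp T}.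
Proof.
apply: (@mklin _ _ (fun s => to_subsp (fST _ (subsp_valP s)))) => a u v.
by apply: val_inj; apply: (linearP f).
Defined.

End SubspaceMaps.

End LinearAlgebra.

Section PersistenceModules.
Variable K : fieldType.

Record pmod d (P : porderType d) := PMod {
  pm_obj :> P -> lmodType K;
  pm_map : forall x y, (x <= y)%O -> {linear pm_obj x -> pm_obj y};
  pm_id : forall x (xx : (x <= x)%O) v, pm_map xx v = v;
  pm_comp : forall x y z (xy : (x <= y)%O) (yz : (y <= z)%O) (xz : (x <= z)%O) v,
    pm_map yz (pm_map xy v) = pm_map xz v }.

Record pm_hom d (P : porderType d) (M N : pmod P) := PMHom {
  pm_fun :> forall x, {linear M x -> N x};
  pm_nat : forall x y (xy : (x <= y)%O) v,
    pm_fun y (pm_map M xy v) = pm_map N xy (pm_fun x v) }.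

Section Basics.
Context {d} {P : porderType d}.
Implicit Types M N A B Q : pmod P.

Definition pm_iso M N : Prop :=
  exists (f : pm_hom M N) (g : pm_hom N M),
    (forall x v, g x (f x v) = v) /\ (forall x v, f x (g x v) = v).

Definition pm_epi M N (f : pm_hom M N) : Prop :=
  forall x w, exists v, f x v = w.

Definition pm_exact A B Q (f : pm_hom A B) (g : pm_hom B Q) : Prop :=
  forall x v, g x v = 0 <-> exists u, f x u = v.

Definition pm_zero M : Prop := forall x (v : M x), v = 0.

Definition pm_projective Q : Prop :=
  forall A B (p : pm_hom A B) (f : pm_hom Q B), pm_epi p ->
    exists g : pm_hom Q A, forall x v, p x (g x v) = f x v.

(* A resolution of length m is stored as an infinite one that vanishes in
   degrees > m. *)
Definition pdim_le (m : nat) M : Prop :=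
  exists (Q : nat -> pmod P) (del : forall i, pm_hom (Q i.+1) (Q i))
         (aug : pm_hom (Q 0%N) M),
    [/\ forall i, (i <= m)%N -> pm_projective (Q i),
        forall i, (m < i)%N -> pm_zero (Q i),
        pm_epi aug,
        pm_exact (del 0%N) aug
      & forall i, pm_exact (del i.+1) (del i)].

Lemma row_bool_id (b : bool) (v : 'rV[K]_b) : v *m const_mx 1 = v.
Proof.
case: b v => v; last by apply/rowP => -[].
by apply/rowP => j; rewrite mxE big_ord1 mxE mulr1 (ord1 j).
Qed.

Lemma row_bool_comp (b c e : bool) (v : 'rV[K]_b) : (b -> c) ->
  v *m (const_mx 1 : 'M_(b, c)) *m (const_mx 1 : 'M_(c, e)) = v *m const_mx 1.
Proof.
case: b v => v bc; last by apply/rowP => j; rewrite -mulmxA !mxE !big_ord0.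
have {bc}-> : c = true by apply: bc.
by rewrite row_bool_id.
Qed.

(* (x <= y)%O : bool is read as a dimension, 1 or 0. *)
Definition pm_free (x : P) : pmod P.
Proof.
apply: (@PMod _ P (fun y => 'rV[K]_(x <= y)%O)
  (fun y z _ => mulmxr (const_mx 1 : 'M[K]_((x <= y)%O, (x <= z)%O)))).
- by move=> y yy v; apply: row_bool_id.
- move=> y z t yz zt yt v; apply: row_bool_comp => xy.
  exact: le_trans xy yz.
Defined.

Definition pm_dsum (I : finType) (M : I -> pmod P) : pmod P.
Proof.
apply: (@PMod _ P (fun x => dprod (fun i => M i x))
  (fun x y xy => dprod_map (fun i => pm_map (M i) xy))).
- by move=> x xx s; apply: functional_extensionality_dep => i; apply: pm_id.
- move=> x y z xy yz xz s; apply: functional_extensionality_dep => i.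
  exact: pm_comp.
Defined.

Definition fin_gen M : Prop :=
  exists (r : nat) (x : 'I_r -> P) (p : pm_hom (pm_dsum (fun i => pm_free (x i))) M),
    pm_epi p.

Section Image.
Variables (M N : pmod P) (f : pm_hom M N).

Lemma pm_map_image x y (xy : (x <= y)%O) w :
  image (f x) w -> image (f y) (pm_map N xy w).
Proof. by case=> v <-; exists (pm_map M xy v); apply: pm_nat. Qed.

Definition pm_im : pmod P.
Proof.
apply: (@PMod _ P (fun x => subsp (image (f x)))
  (fun x y xy => subsp_map (pm_map_image xy))).
- by move=> x xx v; apply: val_inj; apply: pm_id.
- by move=> x y z xy yz xz v; apply: val_inj; apply: pm_comp.
Defined.

End Image.

End Basics.

Section Pullback.
Context {d} {P : porderType d} {d'} {Q : porderType d'}.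
Variable f : {omorphism Q -> P}.

Definition pm_pull (M : pmod P) : pmod Q.
Proof.
apply: (@PMod _ Q (fun x => M (f x)) (fun x y xy => pm_map M (omorph_le f xy))).
- by move=> x xx v; apply: pm_id.
- by move=> x y z xy yz xz v; apply: pm_comp.
Defined.

Definition pm_pull_hom (M N : pmod P) (g : pm_hom M N) :
  pm_hom (pm_pull M) (pm_pull N).
Proof.
apply: (@PMHom _ Q (pm_pull M) (pm_pull N) (fun x => g (f x))).
by move=> x y xy v; apply: (pm_nat g (omorph_le f xy)).
Defined.

End Pullback.

Section TotalFiber.

(* A k-cube of vector spaces is a functor on the poset {set 'I_k}. *)
Local Notation cube k := (pmod {set 'I_k}).

Section Faces.
Variable k : nat.
Implicit Types S T : {set 'I_k}.

Definition front_set S : {set 'I_k.+1} := widen_ord (leqnSn k) @: S.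
Definition back_set S : {set 'I_k.+1} := ord_max |: front_set S.

Lemma front_set_le : {homo front_set : S T / (S <= T)%O}.
Proof. by move=> S T; apply: imsetS. Qed.
Lemma back_set_le : {homo back_set : S T / (S <= T)%O}.
Proof. by move=> S T ST; apply/setUS/imsetS. Qed.
Lemma front_back_le S : (front_set S <= back_set S)%O.
Proof. exact: subsetUr. Qed.

HB.instance Definition _ :=
  Order.isOrderMorphism.Build _ _ _ _ front_set front_set_le.
HB.instance Definition _ :=
  Order.isOrderMorphism.Build _ _ _ _ back_set back_set_le.

Definition front (X : cube k.+1) : cube k := pm_pull front_set X.
Definition back (X : cube k.+1) : cube k := pm_pull back_set X.

Definition front_hom (X Y : cube k.+1) (f : pm_hom X Y) :
  pm_hom (front X) (front Y) := pm_pull_hom front_set f.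
Definition back_hom (X Y : cube k.+1) (f : pm_hom X Y) :
  pm_hom (back X) (back Y) := pm_pull_hom back_set f.

Definition front_back (X : cube k.+1) : pm_hom (front X) (back X).
Proof.
apply: (@PMHom _ _ (front X) (back X)
  (fun S => pm_map X (front_back_le S))) => S T ST v.
have fb := le_trans (front_set_le ST) (front_back_le T).
by rewrite /= !(pm_comp _ _ fb).
Defined.

End Faces.

(* The recursion defining the total fiber of a (k+1)-cube needs its action on
   natural transformations, and that this action preserves commutative
   squares. *)
Record fiber_functor k := FiberFunctor {
  ff_obj : cube k.+1 -> lmodType K;
  ff_map : forall X Y, pm_hom X Y -> {linear ff_obj X -> ff_obj Y};
  ff_square : forall X Y Y' Z (a : pm_hom X Y) (b : pm_hom Y Z)
      (a' : pm_hom X Y') (b' : pm_hom Y' Z),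
    (forall S v, b S (a S v) = b' S (a' S v)) ->
    forall t, ff_map b (ff_map a t) = ff_map b' (ff_map a' t) }.

Lemma le_set01 : ((set0 : {set 'I_1}) <= [set ord0])%O.
Proof. exact: sub0set. Qed.

Lemma kernel1 (X Y : cube 1) (f : pm_hom X Y) v :
  kernel (pm_map X le_set01) v -> kernel (pm_map Y le_set01) (f set0 v).
Proof. by move=> Xv0; rewrite /= -pm_nat Xv0 raddf0. Qed.

Definition fiber1 : fiber_functor 0.
Proof.
apply: (@FiberFunctor 0 (fun X => subsp (kernel (pm_map X le_set01)))
  (fun X Y f => subsp_map (@kernel1 X Y f))).
by move=> X Y Y' Z a b a' b' sq t; apply: val_inj; apply: sq.
Defined.

Section FiberSucc.
Variables (k : nat) (G : fiber_functor k).

Lemma kernelS (X Y : cube k.+2) (f : pm_hom X Y) t :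
  kernel (ff_map G (front_back X)) t ->
  kernel (ff_map G (front_back Y)) (ff_map G (front_hom f) t).
Proof.
move=> Xt0; rewrite /= (ff_square (a' := front_back X) (b' := back_hom f)).
  by rewrite Xt0 raddf0.
by move=> S v; rewrite /= (pm_nat f (front_back_le S)).
Qed.

Definition fiberS : fiber_functor k.+1.
Proof.
apply: (@FiberFunctor k.+1 (fun X => subsp (kernel (ff_map G (front_back X))))
  (fun X Y f => subsp_map (@kernelS X Y f))).
move=> X Y Y' Z a b a' b' sq t; apply: val_inj => /=.
by apply: ff_square => S v; apply: sq.
Defined.

End FiberSucc.

Fixpoint fiber_rec k : fiber_functor k :=
  if k is k'.+1 then fiberS (fiber_rec k') else fiber1.

Definition tfib k (X : cube k.+1) : lmodType K := ff_obj (fiber_rec k) X.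

End TotalFiber.

(* A square in a lattice is cocartesian iff its terminal vertex is the join of
   the two middle ones, and cartesian iff its initial vertex is their meet; for
   all faces of dimension >= 2 of X, these conditions amount to X preserving
   binary joins and meets. *)
Definition strongly_bicartesian d (P : latticeType d) k
    (X : {omorphism {set 'I_k} -> P}) : Prop :=
  forall S T : {set 'I_k},
    X (S :|: T) = (X S `|` X T)%O /\ X (S :&: T) = (X S `&` X T)%O.

Definition cross_degree d (P : latticeType d) (k : nat) (M : pmod P) : Prop :=
  forall X : {omorphism {set 'I_k.+1} -> P}, strongly_bicartesian X ->
    forall t : tfib (pm_pull X M), t = 0.

Section MeetDimension.
Context {d} {P : finLatticeType d}.

Definition meet_irreducible (v : P) : bool :=
  [forall x : P, forall y : P, (v < x)%O && (v < y)%O ==> (v != x `&` y)%O].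

Definition maximal (v : P) : bool := [forall x : P, ~~ (v < x)%O].

Definition is_meet (v : P) (s : seq P) : bool :=
  [forall u : P, (u <= v)%O == all (fun m => (u <= m)%O) s].

Definition meet_of_irreducibles (v : P) (k : nat) : bool :=
  [exists s : k.-tuple P, all meet_irreducible s && is_meet v s].

Lemma meet_of_irreducibles_ex v : exists k, meet_of_irreducibles v k.
Proof.
pose s := [seq m <- enum P | meet_irreducible m && (v <= m)%O].
exists (size s); apply/existsP; exists (in_tuple s); apply/andP; split.
  by apply/allP => m; rewrite mem_filter => /andP[/andP[]].
apply/forallP => u; apply/eqP; apply/idP/idP => [uv|/allP].
  by apply/allP => m; rewrite mem_filter => /andP[/andP[_ vm] _]; apply: le_trans vm.
have [c] := ubnP #|[set x : P | (v <= x)%O]|.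
rewrite {}/s; elim: c v => // c IH v cv us.
have us' m : meet_irreducible m -> (v <= m)%O -> (u <= m)%O.
  by move=> mi vm; apply: us; rewrite mem_filter mi vm mem_enum.
have [|] := boolP (meet_irreducible v); first by move/us'; apply.
rewrite negb_forall => /existsP[x]; rewrite negb_forall => /existsP[y].
rewrite negb_imply negbK => /andP[/andP[vx vy] /eqP vE].
have up z : (v < z)%O -> (u <= z)%O.
  move=> vz; apply: IH => [|m].
    rewrite -ltnS; apply: leq_trans cv; rewrite ltnS; apply/proper_card/properP; split.
      by apply/subsetP => t; rewrite !inE; apply: le_trans (ltW vz).
    by exists v; rewrite !inE ?lexx // lt_geF.
  rewrite mem_filter => /andP[/andP[mi zm] _].
  by apply: us' => //; apply: le_trans zm; apply: ltW.
by rewrite vE lexI !up.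
Qed.

Definition mdim (v : P) : nat :=
  if maximal v then 0%N else ex_minn (meet_of_irreducibles_ex v).

End MeetDimension.

Section Gamma.
Context {d} {P : finLatticeType d}.
Variables (k : nat) (M : pmod P).

(* The elements of P^{<= k} above x. *)
Definition above (x : P) : Type := {v : P | (x <= v)%O && (mdim v <= k)%N}.

Lemma above_le x (v : above x) : (x <= val v)%O.
Proof. by case/andP: (valP v). Qed.

Definition above_incl x y (xy : (x <= y)%O) (v : above y) : above x.
Proof.
exists (val v); case/andP: (valP v) => yv ->.
by rewrite (le_trans xy yv).
Defined.

(* The limit of M over [above x]: the compatible families. *)
Definition T_lim (x : P) : subspace (dprod (fun v : above x => M (val v))).
Proof.
apply: (@Subspace K (dprod (fun v : above x => M (val v))) (fun s =>
  forall (v w : above x) (vw : (val v <= val w)%O), pm_map M vw (s v) = s w)).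
- by move=> v w vw; apply: raddf0.
- by move=> a s t sP tP v w vw; rewrite linearP sP tP.
Defined.

Lemma T_lim_restrict x y (xy : (x <= y)%O) s : T_lim x s ->
  T_lim y (dprod_reindex (fun v : above x => M (val v)) (above_incl xy) s).
Proof. by move=> sP v w vw; apply: (sP (above_incl xy v) (above_incl xy w)). Qed.

Definition T_pm : pmod P.
Proof.
apply: (@PMod _ P (fun x => subsp (T_lim x))
  (fun x y xy => subsp_map (@T_lim_restrict x y xy))).
- move=> x xx s; apply: val_inj; apply: functional_extensionality_dep => v /=.
  have := subsp_valP s (above_incl xx v) v (lexx _).
  by rewrite pm_id.
- move=> x y z xy yz xz s; apply: val_inj.
  apply: functional_extensionality_dep => v /=.
  have := subsp_valP s (above_incl xy (above_incl yz v)) (above_incl xz v) (lexx _).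
  by rewrite pm_id.
Defined.

Lemma eta_lim x (m : M x) :
  T_lim x (dprod_tuple (fun v : above x => pm_map M (above_le v)) m).
Proof. by move=> v w vw; apply: pm_comp. Qed.

Definition eta : pm_hom M T_pm.
Proof.
apply: (@PMHom _ P M T_pm (fun x => corestrict (@eta_lim x))).
move=> x y xy m; apply: val_inj; apply: functional_extensionality_dep => v /=.
exact: pm_comp.
Defined.

Definition Gamma : pmod P := pm_im eta.

End Gamma.

End PersistenceModules.

Section OrderDimension.
Context {d} {P : porderType d}.

Definition embeds_in_chains (m : nat) : Prop :=
  exists (e : Order.disp_t) (L : 'I_m -> orderType e) (f : forall i, P -> L i),
    forall x y : P, (x <= y)%O <-> forall i, (f i x <= f i y)%O.

Definition has_order_dim (n : nat) : Prop :=
  embeds_in_chains n /\ forall m, embeds_in_chains m -> (n <= m)%N.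

End OrderDimension.

Arguments has_order_dim {d} P n.

(* Main.v *)
Require Import Defs.
From HB Require Import structures.
From mathcomp Require Import all_boot all_order all_algebra.
From mathcomp Require Import boolp.
From mathcomp Require classical_sets.

Set Implicit Arguments.
Unset Strict Implicit.
Unset Printing Implicit Defensive.

Import Order.TTheory GRing.Theory.
(* Cubes are indexed by {set 'I_k} ordered by inclusion. *)
Import Order.DefaultSetSubsetOrder.

Local Open Scope ring_scope.

(** All three conditions say that a certain homology of [F] vanishes. In a
    distributive lattice a strongly bicartesian cube is the same thing as an
    element [y] (its terminal vertex) with a list [l] of elements any two of
    which join to something above [y]: the vertices are the meets of [y] with
    the sublists of [l]. Totalizing [F] over such a cube gives a complex whose
    term of degree [j] is the sum of the [F] (y /\ b_1 /\ ... /\ b_j), and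
    [acyclic m F] says that this complex is exact in all degrees above [m],
    for all cubes. For a cube with as many directions as [m.+1], exactness in
    the top degree is the vanishing of the total fiber.

    - Projective dimension at most [m] is equivalent to [acyclic m]. Free
      modules are acyclic above 0 because extending by zero has a natural
      retraction ([freemod_exact]); the long exact sequence of a cover shifts
      the bound by one ([exact_at_quotient], [exact_at_kernel]). What remains
      is the start of the induction: a module acyclic above 0 is projective
      ([acyclic0_projective]). For this, choose in every [M y] a complement of
      the part coming from below; the free module on these complements maps
      onto [M], and exactness in degree 1, applied to the cube spanned by the
      elements covered by [y], says that nothing is killed.

    - If [P] embeds in a product of [n] chains, a cube without degenerate
      direction has at most [n] directions ([coindep_size]), while degenerate
      cubes are exact in every degree ([degenerate_exact]). So [acyclic n.-1]
      concerns only the top degree of the cubes with [n] directions, and there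
      it is the condition of being cross-degree [n.-1]
      ([corner_free_acyclic]).

    - [F] is isomorphic to its image in [T_pm] if and only if a vector of
      [F x] vanishes as soon as it dies in all [F v] with [v] above [x] of
      meet-dimension at most [n.-1] ([Gamma_iso_separated]). This implies
      cross-degree [n.-1] since a meet of fewer than [n] meet-primes above the
      initial vertex of a cube with [n] directions lies above one of the [n]
      vertices next to it ([separated_cross_degree]). Conversely, an
      irredundant expression of [x] as a meet of at least [n]
      meet-irreducibles spans a cube with initial vertex [x], and descending
      induction on [x] applies to the vertices next to it
      ([corner_free_separated]). *)

(** * Complements of subspaces *)

Section Complements.
Context {K : fieldType}.

Lemma subspaceD (V : lmodType K) (S : subspace V) u v : S u -> S v -> S (u + v).
Proof. by move=> Su Sv; rewrite -[u]scale1r; apply: subspaceP. Qed.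

Lemma subspaceZ (V : lmodType K) (S : subspace V) a u : S u -> S (a *: u).
Proof. by move=> Su; rewrite -[_ *: _]addr0; apply/subspaceP/subspace0. Qed.

Lemma subspaceN (V : lmodType K) (S : subspace V) u : S u -> S (- u).
Proof. by move=> Su; rewrite -scaleN1r; apply: subspaceZ. Qed.

Lemma subspaceB (V : lmodType K) (S : subspace V) u v : S u -> S v -> S (u - v).
Proof. by move=> Su Sv; apply/subspaceD/subspaceN. Qed.

Definition compl (V : lmodType K) (S W : subspace V) : Prop :=
  (forall v, S v -> W v -> v = 0) /\
  (forall v, exists s w, [/\ S s, W w & v = s + w]).

Definition zero_subspace (V : lmodType K) : subspace V.
Proof.
apply: (@Subspace _ _ (fun v : V => v = 0)) => // a u v -> ->.
by rewrite scaler0 addr0.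
Defined.

Definition add_line (V : lmodType K) (W : subspace V) (v : V) : subspace V.
Proof.
apply: (@Subspace _ _ (fun u : V => exists w a, W w /\ u = w + a *: v)).
  by exists 0, 0; split; [apply: subspace0|rewrite scale0r addr0].
move=> a _ _ [w [b [Ww ->]]] [w' [b' [Ww' ->]]].
exists (a *: w + w'), (a * b + b'); split; first exact: subspaceP.
by rewrite scalerDr scalerA scalerDl addrACA.
Defined.

(** Zorn's lemma: a subspace maximal among those meeting [S] trivially is a
    complement, for otherwise a line could be added to it. *)
Lemma complement_exists (V : lmodType K) (S : subspace V) :
  exists W, compl S W.
Proof.
pose T := {W : subspace V | forall v, S v -> W v -> v = 0}.
pose R (A B : T) : bool := `[< forall v, sval A v -> sval B v >].
have R_refl t : R t t by apply/asboolP.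
have R_trans r s t : R r s -> R s t -> R r t.
  by move=> /asboolP rs /asboolP st; apply/asboolP => v /rs /st.
have T0 : T by exists (zero_subspace V).
have chain (A : classical_sets.set T) :
    classical_sets.total_on A (fun x y => R x y) ->
    exists t : T, forall s : T, A s -> R s t.
  move=> totA; have [[a Aa]|A0] := pselect (exists a, A a); last first.
    by exists T0 => s As; case: A0; exists s.
  have [U UE] : exists U : subspace V,
      forall v, U v <-> exists2 s, A s & sval s v.
    unshelve eexists (@Subspace _ _ (fun v => exists2 s, A s & sval s v) _ _).
    - by exists a => //; apply: subspace0.
    - move=> c u v [s As su] [t At tv].
      have [/asboolP st|/asboolP ts] := totA s t As At.
        by exists t => //; apply: subspaceP => //; apply: st.
      by exists s => //; apply: subspaceP => //; apply: ts.
    - by [].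
  have US v : S v -> U v -> v = 0.
    by move=> Sv /UE[s _ sv]; apply: (svalP s).
  exists (exist _ U US) => s As.
  by apply/asboolP => v sv /=; apply/UE; exists s.
have [W' Wmax] := classical_sets.ZL_preorder T0 R_refl R_trans chain.
pose W := sval W'; have WS : forall v, S v -> W v -> v = 0 := svalP W'.
exists W; split=> // v.
apply: contrapT => nv.
have vS w a : W w -> S (w + a *: v) -> a = 0.
  move=> Ww Sv; apply/eqP; apply/negPn/negP => a0; apply: nv.
  exists (a^-1 *: (w + a *: v)), (- (a^-1 *: w)); split.
  - exact: subspaceZ.
  - exact/subspaceN/subspaceZ.
  - by rewrite scalerDr scalerA mulVf // scale1r addrC addKr.
have line u : S u -> add_line W v u -> u = 0.
  move=> Su [w [a [Ww uE]]]; move: Su; rewrite uE => Su.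
  have a0 := vS _ _ Ww Su; move: Su.
  by rewrite a0 scale0r addr0 => Su; apply: WS.
have W_line : R W' (exist _ (add_line W v) line).
  apply/asboolP => u Wu; exists u, 0.
  by split=> //; rewrite scale0r addr0.
have /asboolP line_W := Wmax _ W_line.
apply: nv; exists 0, v; rewrite add0r; split=> //; first exact: subspace0.
apply: line_W; exists 0, 1.
by split; [apply: subspace0|rewrite add0r scale1r].
Qed.

(** A complement of the kernel of [p] maps bijectively onto the target. *)
Lemma linear_section (A B : lmodType K) (p : {linear A -> B}) :
  (forall b, exists a, p a = b) ->
  exists g : {linear B -> A}, forall b, p (g b) = b.
Proof.
move=> p_surj; have [W [kerW sumW]] := complement_exists (kernel p).
have lift b : {a | W a /\ p a = b}.
  apply: cid; have [a <-] := p_surj b; have [s [w [ps0 Ww ->]]] := sumW a.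
  by exists w; split=> //; rewrite raddfD /= ps0 add0r.
have lift_uniq a a' : W a -> W a' -> p a = p a' -> a = a'.
  move=> Wa Wa' paa'; apply/eqP; rewrite -subr_eq0; apply/eqP/kerW.
    by rewrite /= raddfB /= paa' subrr.
  exact: subspaceB.
have g_lin : linear (fun b => sval (lift b)).
  move=> c u v; case: (lift u) (lift v) (lift (c *: u + v)).
  move=> a [Wa pa] [a' [Wa' pa']] [a'' [Wa'' pa'']] /=.
  by apply: lift_uniq => //; [apply: subspaceP|rewrite linearP pa pa'].
by exists (mklin g_lin) => b /=; case: (lift b) => a [].
Qed.

End Complements.

(** * Persistence modules: transition maps, kernels, images *)

Section Transitions.
Context {K : fieldType} {d : Order.disp_t} {P : porderType d}.
Implicit Types M N : pmod K P.

(** Extending the transition maps by zero to incomparable pairs removes the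
    comparability proofs from all formulas below. *)
Definition tr M x y : M x -> M y :=
  if @idP (x <= y)%O is ReflectT xy then pm_map M xy else fun=> 0.

Lemma tr_linear M x y : linear (@tr M x y).
Proof.
rewrite /tr; case: {-}_ / idP => [xy|_] a u v; first exact: linearP.
by rewrite scaler0 addr0.
Qed.

HB.instance Definition _ M x y :=
  GRing.isLinear.Build K (M x) (M y) *:%R (@tr M x y) (@tr_linear M x y).

Lemma trE M x y (xy : (x <= y)%O) v : tr y v = pm_map M xy v.
Proof. 
rewrite /tr; case: {-}_ / idP => // xy'; by rewrite (bool_irrelevance xy' xy).
Qed.

Lemma tr_id M x (v : M x) : tr x v = v.
Proof. by rewrite (trE (lexx x)) pm_id. Qed.

Lemma tr_comp M x y z (v : M x) :
  (x <= y)%O -> (y <= z)%O -> tr z (tr y v) = tr z v.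
Proof. by move=> xy yz; rewrite !trE ?(le_trans xy yz) // => xz; apply: pm_comp. Qed.

Lemma tr_hom M N (f : pm_hom M N) x y (v : M x) :
  f y (tr y v) = tr y (f x v).
Proof. by rewrite /tr; case: {-}_ / idP => xy; [apply: pm_nat|apply: raddf0]. Qed.

Lemma pm_inverse M N (f : pm_hom M N) :
  (forall x v, f x v = 0 -> v = 0) -> pm_epi f ->
  exists g : pm_hom N M, (forall x v, g x (f x v) = v) /\
                         (forall x w, f x (g x w) = w).
Proof.
move=> f_inj f_epi; pose g x w := sval (cid (f_epi x w)).
have fg x w : f x (g x w) = w by rewrite /g; case: cid.
have gE x v w : f x v = w -> g x w = v.
  move=> fvw; apply/eqP; rewrite -subr_eq0; apply/eqP/(f_inj x).
  by rewrite raddfB /= fg fvw subrr.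
have g_lin x : linear (g x).
  by move=> a u v; apply: gE; rewrite linearP !fg.
unshelve eexists (@PMHom _ _ _ _ _ (fun x => mklin (@g_lin x)) _).
  by move=> x y xy v /=; apply: gE; rewrite pm_nat fg.
by split=> [x v|x w]; [apply: gE|apply: fg].
Qed.

Lemma projective_iso M N (f : pm_hom M N) :
  (forall x v, f x v = 0 -> v = 0) -> pm_epi f ->
  pm_projective M -> pm_projective N.
Proof.
move=> f_inj f_epi M_proj A B p h p_epi.
have [g [_ fg]] := pm_inverse f_inj f_epi.
unshelve epose (hf := @PMHom _ _ _ M B (fun x => h x \o f x) _).
  by move=> x y xy v /=; rewrite !pm_nat.
have [k pk] := M_proj _ _ p hf p_epi.
unshelve eexists (@PMHom _ _ _ N A (fun x => k x \o g x) _).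
  by move=> x y xy v /=; rewrite !pm_nat.
by move=> x v /=; rewrite pk /= fg.
Qed.

Section Kernel.
Variables (M N : pmod K P) (f : pm_hom M N).

Lemma pm_map_kernel x y (xy : (x <= y)%O) v :
  kernel (f x) v -> kernel (f y) (pm_map M xy v).
Proof. by move=> fv0; rewrite /= pm_nat fv0 raddf0. Qed.

Definition pm_ker : pmod K P.
Proof.
apply: (@PMod _ _ P (fun x => subsp (kernel (f x)))
  (fun x y xy => subsp_map (@pm_map_kernel x y xy))).
- by move=> x xx v; apply: val_inj; apply: pm_id.
- by move=> x y z xy yz xz v; apply: val_inj; apply: pm_comp.
Defined.

Definition pm_ker_incl : pm_hom pm_ker M.
Proof.
unshelve eapply (@PMHom _ _ _ pm_ker M
  (fun x => mklin (_ : linear (fun v : pm_ker x => val v)))) => //.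
Defined.

Lemma pm_ker_incl_exact : pm_exact pm_ker_incl f.
Proof.
move=> x v; split=> [fv0|[u <-]]; last exact: subsp_valP u.
by exists (to_subsp (fv0 : kernel (f x) v)).
Qed.

Lemma pm_ker_incl_inj x v : pm_ker_incl x v = 0 -> v = 0.
Proof. by move=> v0; apply: val_inj. Qed.

Definition pm_to_im : pm_hom M (pm_im f).
Proof.
unshelve eapply (@PMHom _ _ _ M (pm_im f)
  (fun x => @corestrict _ _ _ (f x) (Defs.image (f x)) _)).
  by move=> u; exists u.
by move=> x y xy v; apply: val_inj; apply: pm_nat.
Defined.

Lemma pm_to_im_epi : pm_epi pm_to_im.
Proof.
move=> x w; have [u fu] := subsp_valP w.
by exists u; apply: val_inj.
Qed.

Definition pm_im_incl : pm_hom (pm_im f) N.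
Proof.
unshelve eapply (@PMHom _ _ _ (pm_im f) N
  (fun x => mklin (_ : linear (fun v : pm_im f x => val v)))) => //.
Defined.

Lemma pm_im_incl_inj x v : pm_im_incl x v = 0 -> v = 0.
Proof. by move=> v0; apply: val_inj. Qed.

End Kernel.
End Transitions.
Arguments tr {K d P M x} y v.

(** * The chain complex of a cube *)

Section Chains.
Context {K : fieldType} {d : Order.disp_t} {P : meetSemilatticeType d}.
Local Open Scope order_scope.
Implicit Types (M N : P -> lmodType K) (l : seq P) (b x y z : P).

(** The cube has terminal vertex [y] and one direction for each entry of the
    list; its total complex is built as an iterated mapping cone. A pair
    consists of a chain on the face that contains [y] and of one on the
    opposite face, whose terminal vertex is [y `&` b]. This recursion keeps
    signs and permutations of the directions out of the argument. *)
Fixpoint chains M l : P -> lmodType K :=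
  if l is b :: l' then
    fun y => (chains M l' y * chains M l' (y `&` b))%type : lmodType K
  else M.

(** The degree of a component is its number of meets with entries of the list,
    so that degree 0 is [M y] and the top degree is the initial vertex. *)
Fixpoint homog M l : forall y, nat -> chains M l y -> Prop :=
  match l return forall y, nat -> chains M l y -> Prop with
  | [::] => fun y j m => j = 0%N \/ m = 0
  | b :: l' => fun y j c => homog j c.1 /\
      (if j is i.+1 then homog i c.2 else c.2 = 0)
  end.

(** The family [g] is indexed by all pairs so that the same construction yields
    the restriction from the cube at [x] to the cube at [y] (with [g] the
    transition maps) and the map induced by a morphism (on the diagonal). *)
Fixpoint cmap M N (g : forall x y, {linear M x -> N y}) l :
    forall x y, chains M l x -> chains N l y :=
  match l return forall x y, chains M l x -> chains N l y with
  | [::] => fun x y m => g x y m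
  | b :: l' => fun x y c =>
      (cmap g y c.1, cmap g (y `&` b) c.2)
  end.

Lemma cmap_linear M N (g : forall x y, {linear M x -> N y}) l x y :
  linear (@cmap M N g l x y).
Proof.
elim: l x y => [|b l IH] x y a u v /=; first exact: linearP.
by rewrite !IH.
Qed.

HB.instance Definition _ M N g l x y :=
  GRing.isLinear.Build K (chains M l x) (chains N l y) *:%R
    (@cmap M N g l x y) (@cmap_linear M N g l x y).

Lemma homogP M l y j a (u v : chains M l y) :
  homog j u -> homog j v -> homog j (a *: u + v).
Proof.
elim: l y j u v => [|b l IH] y j u v /=.
  move=> [j0|->]; first by left.
  by move=> [j0|->]; [left|right; rewrite scaler0 addr0].
case=> hu1 hu2 [hv1 hv2]; split; first exact: IH.
by case: j hu2 hv2 {hu1 hv1} => [-> ->|j]; [rewrite scaler0 addr0|apply: IH].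
Qed.

Lemma homog0 M l y j : homog j (0 : chains M l y).
Proof.
by elim: l y j => [|b l IH] y j /=; [right|split=> //; case: j].
Qed.

Lemma homogZ M l y j a (u : chains M l y) : homog j u -> homog j (a *: u).
Proof. by move=> hu; rewrite -[_ *: _]addr0; apply/homogP/homog0. Qed.

Lemma homogN M l y j (u : chains M l y) : homog j u -> homog j (- u).
Proof. by move=> hu; rewrite -scaleN1r; apply: homogZ. Qed.

Lemma homogD M l y j (u v : chains M l y) :
  homog j u -> homog j v -> homog j (u + v).
Proof. by move=> hu hv; rewrite -[u]scale1r; apply: homogP. Qed.

Lemma homogB M l y j (u v : chains M l y) :
  homog j u -> homog j v -> homog j (u - v).
Proof. by move=> hu hv; apply/homogD/homogN. Qed.

Lemma cmap_homog M N (g : forall x y, {linear M x -> N y}) l x y j c :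
  homog j c -> homog j (@cmap M N g l x y c).
Proof.
elim: l x y j c => [|b l IH] x y j c /=.
  by move=> [->|->]; [left|right; apply: raddf0].
case=> h1 h2; split; first exact: IH.
by case: j h2 {h1} => [->|j]; [apply: raddf0|apply: IH].
Qed.

Lemma homog_gt_size M l y j (c : chains M l y) :
  (size l < j)%N -> homog j c -> c = 0.
Proof.
elim: l y j c => [|b l IH] y [|j] c //=; first by move=> _ [].
rewrite ltnS => lj; case: c => u v /= [hu hv].
by rewrite (IH _ _ _ (leqW lj) hu) (IH _ _ _ lj hv).
Qed.

Lemma cmap_id M (g : forall x y, {linear M x -> M y}) l x :
  (forall x v, g x x v = v) -> forall c, @cmap M M g l x x c = c.
Proof.
move=> gx; elim: l x => [|b l IH] x c /=; first exact: gx.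
by rewrite !IH -surjective_pairing.
Qed.

(** The recursion for chains meets all vertices with the same entry, so an
    identity of families passes to chains if the relation [R] under which it
    holds is stable under such meets. *)
Section Squares.
Variables (M N M' N' : P -> lmodType K).
Variables (g : forall x y, {linear M x -> N y}).
Variables (h : forall x y, {linear N x -> N' y}).
Variables (g' : forall x y, {linear M x -> M' y}).
Variables (h' : forall x y, {linear M' x -> N' y}).
Variable R : P -> P -> P -> P -> Prop.
Hypothesis RI : forall x y x' y' b, R x y x' y' ->
  R (x `&` b) (y `&` b) (x' `&` b) (y' `&` b).

Lemma cmap_square l x y x' y' c :
  (forall x y x' y' v, R x y x' y' -> h y y' (g x y v) = h' x' y' (g' x x' v)) ->
  R x y x' y' ->
  @cmap _ _ h l y y' (@cmap _ _ g l x y c) =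
  @cmap _ _ h' l x' y' (@cmap _ _ g' l x x' c).
Proof.
move=> hg; elim: l x y x' y' c => [|b l IH] x y x' y' c Rx /=; first exact: hg.
by congr pair; apply: IH => //; apply: RI.
Qed.

End Squares.
End Chains.

Section Boundary.
Context {K : fieldType} {d : Order.disp_t} {P : meetSemilatticeType d}.
Local Open Scope order_scope.
Implicit Types (M N : pmod K P) (l : seq P) (b x y z : P).

Notation rho M := (cmap (fun x y => @tr K _ _ M x y)).

Fixpoint bd M l : forall y, chains M l y -> chains M l y :=
  match l return forall y, chains M l y -> chains M l y with
  | [::] => fun y _ => 0
  | b :: l' => fun y c => (rho M y c.2 - bd c.1, bd c.2)
  end.

Lemma bd_linear M l y : linear (@bd M l y).
Proof.
elim: l y => [|b l IH] y a u v /=; first by rewrite scaler0 addr0.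
by rewrite !IH !linearP addrACA -scalerDr.
Qed.

HB.instance Definition _ M l y :=
  GRing.isLinear.Build K (chains M l y) (chains M l y) *:%R
    (@bd M l y) (@bd_linear M l y).

Lemma rho_comp M l x y z (c : chains M l x) : x <= y -> y <= z ->
  rho M z (rho M y c) = rho M z c.
Proof.
move=> xy yz; rewrite -[RHS](cmap_id (g := fun x y => @tr K _ _ M x y)); last first.
  by move=> *; apply: tr_id.
apply: (cmap_square (R := fun x y y' z => [/\ x <= y, y <= z & y' = z])) => //.
  by move=> ? ? ? ? b [? ? ->]; rewrite !leI2.
by move=> ? ? ? ? v [? ? ->] /=; rewrite tr_id tr_comp.
Qed.

Lemma cmap_rho M N (g : forall x y, {linear M x -> N y}) (R : P -> P -> Prop) :
  (forall x y b, R x y -> R (x `&` b) (y `&` b)) ->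
  (forall x y x' y' v, R x y -> R x' y' -> x <= x' -> y <= y' ->
     g x' y' (tr x' v) = tr y' (g x y v)) ->
  forall l x y x' y' (c : chains M l x), R x y -> R x' y' -> x <= x' -> y <= y' ->
  cmap g y' (rho M x' c) = rho N y' (cmap g y c).
Proof.
move=> RI gN l x y x' y' c Rxy Rxy' xx' yy'.
apply: (cmap_square (R := fun x x' y y' =>
  [/\ R x y, R x' y', x <= x' & y <= y'])) => //.
  by move=> ? ? ? ? b [? ? ? ?]; rewrite !leI2 //; split=> //; apply: RI.
by move=> ? ? ? ? v []; apply: gN.
Qed.

Lemma bd_cmap M N (g : forall x y, {linear M x -> N y}) (R : P -> P -> Prop) :
  (forall x y b, R x y -> R (x `&` b) (y `&` b)) ->
  (forall x y x' y' v, R x y -> R x' y' -> x <= x' -> y <= y' ->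
     g x' y' (tr x' v) = tr y' (g x y v)) ->
  forall l x y (c : chains M l x), R x y -> cmap g y (bd c) = bd (cmap g y c).
Proof.
move=> RI gN; elim=> [|b l IH] x y c Rxy /=; first by rewrite raddf0.
rewrite raddfB /= !IH //; last exact: RI.
by rewrite (cmap_rho RI gN _ (RI _ _ _ Rxy) Rxy) ?leIl.
Qed.

Lemma bd_rho M l x y (c : chains M l x) : x <= y ->
  rho M y (bd c) = bd (rho M y c).
Proof.
apply: (bd_cmap (R := fun x y => x <= y)) => [x' y' b xy'|x' y' x'' y'' v xy' xy'' xx' yy'] /=.
  by rewrite leI2.
by rewrite !tr_comp.
Qed.

Lemma bd_bd M l y (c : chains M l y) : bd (bd c) = 0.
Proof.
elim: l y c => [|b l IH] y c //=.
by rewrite raddfB /= IH subr0 bd_rho ?leIl // subrr IH.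
Qed.

Lemma bd_homog0 M l y (c : chains M l y) : homog 0 c -> bd c = 0.
Proof.
elim: l y c => [|b l IH] y // [u v] /= [hu ->].
by rewrite !raddf0 IH // subr0.
Qed.

Lemma bd_homog M l y j (c : chains M l y) : homog j.+1 c -> homog j (bd c).
Proof.
elim: l y j c => [|b l IH] y j c /=; first by right.
case=> h1 h2; split.
  by apply: homogB; [apply: cmap_homog|apply: IH].
by case: j {h1} h2 => [|j] h2; [apply: bd_homog0|apply: IH].
Qed.
End Boundary.

(** * Exactness and dimension shifting *)

Section Shifting.
Context {K : fieldType} {d : Order.disp_t} {P : meetSemilatticeType d}.
Local Open Scope order_scope.
Implicit Types (M N : pmod K P) (l : seq P) (b x y z : P).

Definition hom_at M N (f : pm_hom M N) x y : {linear M x -> N y} :=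
  @tr K d P N x y \o f x.

Definition chom M N (f : pm_hom M N) l y : {linear chains M l y -> chains N l y} :=
  @cmap K d P M N (hom_at f) l y y.

Lemma chom_homog M N (f : pm_hom M N) l y j (c : chains M l y) :
  homog j c -> homog j (chom f l y c).
Proof. exact: cmap_homog. Qed.

Lemma chom_bd M N (f : pm_hom M N) l y (c : chains M l y) :
  chom f l y (bd c) = bd (chom f l y c).
Proof.
apply: (bd_cmap (R := fun x y => x = y)) => // [x x' b -> //|].
by move=> x _ x' _ v <- <- xx' _; rewrite /hom_at /= !tr_id tr_hom.
Qed.

Lemma chom_surj M N (f : pm_hom M N) l y j (c : chains N l y) :
  pm_epi f -> homog j c -> exists e, homog j e /\ chom f l y e = c.
Proof.
move=> f_epi; rewrite /chom; elim: l y j c => [|b l IH] y j c /=.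
  case=> [->|->]; last by exists 0; split; [right|rewrite !raddf0].
  have [m fm] := f_epi y c.
  by exists m; split; [left|rewrite /hom_at /= tr_id].
case: c => u v /= [hu hv]; have [u' [hu' <-]] := IH _ _ _ hu.
case: j hv {hu} hu' => [->|j hv] hu'.
  by exists (u', 0); split=> //=; rewrite raddf0.
by have [v' [hv' <-]] := IH _ _ _ hv; exists (u', v').
Qed.

Lemma chom_inj M N (f : pm_hom M N) l y (c : chains M l y) :
  (forall x v, f x v = 0 -> v = 0) -> chom f l y c = 0 -> c = 0.
Proof.
move=> f_inj; rewrite /chom; elim: l y c => [|b l IH] y c /=.
  by rewrite /hom_at /= tr_id => /f_inj.
by case: c => u v [/IH -> /IH ->].
Qed.

Lemma chom_exact L M N (f : pm_hom L M) (g : pm_hom M N) l y j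
    (c : chains M l y) :
  pm_exact f g -> homog j c -> chom g l y c = 0 ->
  exists e, homog j e /\ chom f l y e = c.
Proof.
move=> fg; rewrite /chom; elim: l y j c => [|b l IH] y j c /=.
  case=> [->|->]; last by exists 0; split; [right|rewrite !raddf0].
  rewrite /hom_at /= tr_id => /fg[m <-].
  by exists m; split; [left|rewrite tr_id].
case: c => u v /= [hu hv] [gu gv]; have [u' [hu' <-]] := IH _ _ _ hu gu.
case: j hv {hu} hu' => [->|j hv] hu'.
  by exists (u', 0); split=> //=; rewrite raddf0.
by have [v' [hv' <-]] := IH _ _ _ hv gv; exists (u', v').
Qed.

Lemma chom_comp0 L M N (f : pm_hom L M) (g : pm_hom M N) l y (c : chains L l y) :
  pm_exact f g -> chom g l y (chom f l y c) = 0.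
Proof.
move=> fg; rewrite /chom; elim: l y c => [|b l IH] y c /=.
  by rewrite /hom_at /= !tr_id; apply/fg; exists c.
by rewrite !IH.
Qed.

Lemma chom_id M N (f : pm_hom M N) (g : pm_hom N M) l y c :
  (forall x v, g x (f x v) = v) -> chom g l y (chom f l y c) = c.
Proof.
move=> gf; rewrite /chom; elim: l y c => [|b l IH] y c /=.
  by rewrite /hom_at /= !tr_id gf.
by rewrite !IH -surjective_pairing.
Qed.

(** Exactness in degree [j.+1]: degree 0 never enters. *)
Definition exact_at M l y j : Prop := forall c : chains M l y,
  homog j.+1 c -> bd c = 0 -> exists e, homog j.+2 e /\ bd e = c.

Lemma exact_at_retract M N (f : pm_hom M N) (g : pm_hom N M) l y j :
  (forall x v, g x (f x v) = v) -> exact_at N l y j -> exact_at M l y j.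
Proof.
move=> gf exN c hc dc.
have [|e [he de]] := exN (chom f l y c) (chom_homog f hc).
  by rewrite -chom_bd dc raddf0.
by exists (chom g l y e); rewrite -chom_bd de chom_id //; split=> //; apply: chom_homog.
Qed.

(** The two halves of the long exact homology sequence of a short exact
    sequence of modules that are used below. *)
Section ShortExact.
Variables (L Q M : pmod K P) (f : pm_hom L Q) (g : pm_hom Q M).
Hypotheses (f_inj : forall x v, f x v = 0 -> v = 0) (fg : pm_exact f g)
  (g_epi : pm_epi g).

Lemma exact_at_quotient l y j :
  exact_at Q l y j.+1 -> exact_at L l y j -> exact_at M l y j.+1.
Proof.
move=> exQ exL c hc dc; have [q [hq gq]] := chom_surj g_epi hc.
have [k [hk fk]] : exists k, homog j.+1 k /\ chom f l y k = bd q.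
  apply: (chom_exact fg); first exact: bd_homog.
  by rewrite chom_bd gq.
have [|k' [hk' dk']] := exL k hk.
  by apply: (chom_inj f_inj); rewrite chom_bd fk bd_bd.
have [||e [he de]] := exQ (q - chom f l y k').
- by apply: homogB => //; apply: chom_homog.
- by rewrite raddfB /= -chom_bd dk' fk subrr.
exists (chom g l y e); split; first exact: chom_homog.
by rewrite -chom_bd de raddfB /= gq chom_comp0 ?subr0.
Qed.

Lemma exact_at_kernel l y j :
  exact_at Q l y j -> exact_at M l y j.+1 -> exact_at L l y j.
Proof.
move=> exQ exM c hc dc.
have [||q [hq dq]] := exQ (chom f l y c); first exact: chom_homog.
  by rewrite -chom_bd dc raddf0.
have [||m [hm dm]] := exM (chom g l y q); first exact: chom_homog.
  by rewrite -chom_bd dq chom_comp0.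
have [e [he ge]] := chom_surj g_epi hm.
have [||k [hk fk]] := chom_exact fg (c := q - bd e) (j := j.+2).
- by apply: homogB => //; apply: bd_homog.
- by rewrite raddfB /= chom_bd ge dm subrr.
exists k; split=> //; apply/eqP; rewrite -subr_eq0; apply/eqP.
apply: (chom_inj f_inj); rewrite raddfB /= chom_bd fk.
by rewrite raddfB /= bd_bd subr0 dq subrr.
Qed.

End ShortExact.

(** If the maps from [M (x `&` b)] to [M x] have a natural retraction, the cone
    in direction [b] has the homology of a direct summand of the face that
    contains [y]: for a cycle [(v, u)], lifting [u] by the retraction of [v]
    leaves a cycle of that face. *)
Lemma exact_at_split M b l y j (r : forall x y, {linear M x -> M y}) :
  (forall x x' v, x <= x' ->
     r x' (x' `&` b) (tr x' v) = tr (x' `&` b) (r x (x `&` b) v)) ->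
  (forall x (v : M (x `&` b)), r x (x `&` b) (tr x v) = v) ->
  exact_at M l y j -> exact_at M (b :: l) y j.
Proof.
move=> r_nat r_split ex [v u] /= [hv hu] [/eqP]; rewrite subr_eq0 => /eqP dv du.
(* The retraction acts on chains because [x' = x `&` b] is stable under meets. *)
have RI x x' a : x' = x `&` b -> x' `&` a = (x `&` a) `&` b by move=> ->; rewrite meetAC.
have rN x x' z z' (w : M x) : x' = x `&` b -> z' = z `&` b -> x <= z -> x' <= z' ->
  r z z' (tr z w) = tr z' (r x x' w) by move=> -> -> xz _; apply: r_nat.
pose R := @cmap K d P M M r.
have bdR (c : chains M l y) : R l y (y `&` b) (bd c) = bd (R l y (y `&` b) c).
  exact: (bd_cmap (R := fun x x' => x' = x `&` b)).
have Rrho c : R l y (y `&` b) (cmap (fun x y => @tr K d P M x y) y c) = c.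
  rewrite -[RHS](cmap_id (g := fun x y => @tr K d P M x y)); last first.
    by move=> *; apply: tr_id.
  rewrite -[X in _ = cmap _ _ X](cmap_id (g := fun x y => @tr K d P M x y)); last first.
    by move=> *; apply: tr_id.
  apply: (cmap_square (R := fun x y x' y' => [/\ x = y `&` b, x' = x & y' = x])) => //.
    by move=> x1 x2 x3 x4 a [-> -> ->]; split; rewrite // meetAC.
  by move=> x1 x2 x3 x4 w [e -> ->]; subst x1; rewrite /= r_split !tr_id.
pose rv := R l y (y `&` b) v.
have drv : bd rv = u by rewrite -bdR -dv Rrho.
have [||v' [hv' dv']] := ex (cmap (fun x y => @tr K d P M x y) y rv - v).
- by apply: homogB => //; apply/cmap_homog/cmap_homog.
- by rewrite raddfB /= -bd_rho ?leIl // drv dv subrr.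
exists (v', rv); split; last by rewrite /= drv dv' subKr.
by split=> //; apply: cmap_homog.
Qed.

End Shifting.

(** * Free modules *)

Section Free.
Context {K : fieldType} {d : Order.disp_t} {P : finLatticeType d}.
Local Open Scope order_scope.
Implicit Types (M N : pmod K P) (V : P -> lmodType K) (A : pred P) (x y z b : P).

Definition supported V y : subspace (dprod V).
Proof.
apply: (@Subspace _ (dprod V) (fun s => forall z, ~~ (z <= y) -> s z = 0)) => //.
move=> a s t s0 t0 z zy.
by rewrite -[LHS]/(a *: s z + t z) s0 // t0 // scaler0 addr0.
Defined.

Lemma supported_le V x y (xy : x <= y) s :
  supported V x s -> supported V y ((idfun : {linear dprod V -> dprod V}) s).
Proof. by move=> s0 z zy; apply: s0; apply: contra zy => /le_trans; apply. Qed.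

(** The value at [y] consists of the families supported on the down-set of [y],
    so that all transition maps are inclusions. This is the sum over [z] of the
    modules that are [V z] above [z] and 0 elsewhere. *)
Definition freemod V : pmod K P.
Proof.
apply: (@PMod _ _ P (fun y => subsp (supported V y))
  (fun x y xy => subsp_map (supported_le xy))).
- by move=> x xx v; apply: val_inj.
- by move=> x y z xy yz xz v; apply: val_inj.
Defined.

Lemma freemodE V y (s t : freemod V y) :
  (forall z, val s z = val t z) -> s = t.
Proof. by move=> st; apply/val_inj/functional_extensionality_dep. Qed.

Lemma freemod_supp V y (s : freemod V y) z : ~~ (z <= y) -> val s z = 0.
Proof. exact: (subsp_valP s). Qed.

Lemma freemodP V y a (s t : freemod V y) z :
  val (a *: s + t) z = a *: val s z + val t z.
Proof. by []. Qed.

Lemma freemodD V y (s t : freemod V y) z : val (s + t) z = val s z + val t z.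
Proof. by []. Qed.

Lemma freemodB V y (s t : freemod V y) z : val (s - t) z = val s z - val t z.
Proof. by []. Qed.

Lemma freemod0 V y z : val (0 : freemod V y) z = 0.
Proof. by []. Qed.

Lemma val_tr V x y (s : freemod V x) z : x <= y -> val (tr y s) z = val s z.
Proof. by move=> xy; rewrite trE. Qed.

Lemma cut_supported V A x y (s : freemod V x) :
  supported V y (fun z => if A z && (z <= y) then val s z else 0).
Proof. by move=> z /negPf ->; rewrite andbF. Qed.

(** Truncation to degrees below [y] is defined for all [x] and [y]: for
    [y = x `&` b] it is the natural retraction behind the acyclicity of free
    modules, and for a singleton [A] it extracts a generator. *)
Definition cut V A x y (s : freemod V x) : freemod V y :=
  to_subsp (@cut_supported V A x y s).

Lemma val_cut V A x y (s : freemod V x) z :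
  val (cut A y s) z = if A z && (z <= y) then val s z else 0.
Proof. by []. Qed.

Lemma cut_linear V A x y : linear (@cut V A x y).
Proof.
move=> a s t; apply: freemodE => z; rewrite freemodP !val_cut.
by case: ifP; rewrite ?scaler0 ?addr0.
Qed.

HB.instance Definition _ V A x y :=
  GRing.isLinear.Build K (freemod V x) (freemod V y) *:%R
    (@cut V A x y) (@cut_linear V A x y).

Lemma cut_tr V A x x' y (s : freemod V x) : x <= x' ->
  cut A y (tr x' s) = cut A y s.
Proof. by move=> xx'; apply: freemodE => z; rewrite !val_cut val_tr. Qed.

Lemma freemod_exact V l y j : exact_at (freemod V) l y j.
Proof.
elim: l y => [|b l IH] y.
  by move=> c /= [//|->] _; exists 0; split; [right|].
apply: (exact_at_split (r := fun x y => @cut V predT x y)) => // [x x' s xx'|x s].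
  rewrite /= cut_tr //; apply: freemodE => z; rewrite val_tr ?leI2 // !val_cut /= !lexI.
  by have [zb|] := boolP (z <= b); rewrite ?andbF // !andbT;
    case: ifP => zx'; case: ifP => zx //; rewrite freemod_supp ?zx //;
    rewrite (le_trans zx) in zx'.
rewrite /= cut_tr ?leIl //; apply: freemodE => z; rewrite val_cut /=.
by case: ifPn => // zx; rewrite freemod_supp.
Qed.

(** The universal property of free modules. *)
Definition unfree_fun V M (phi : forall z, {linear V z -> M z}) y
  (s : freemod V y) : M y := \sum_z tr y (phi z (val s z)).

Lemma unfree_linear V M (phi : forall z, {linear V z -> M z}) y :
  linear (@unfree_fun V M phi y).
Proof.
move=> a s t; rewrite /unfree_fun scaler_sumr -big_split; apply: eq_bigr => z _.
by rewrite freemodP !linearP.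
Qed.

HB.instance Definition _ V M phi y :=
  GRing.isLinear.Build K (freemod V y) (M y) *:%R
    (@unfree_fun V M phi y) (@unfree_linear V M phi y).

Definition unfree V M (phi : forall z, {linear V z -> M z}) :
  pm_hom (freemod V) M.
Proof.
apply: (@PMHom _ _ P (freemod V) M (fun y => @unfree_fun V M phi y)).
move=> x y xy s; rewrite /= /unfree_fun raddf_sum; apply: eq_bigr => z _ /=.
have [zx|zx] := boolP (z <= x); first by rewrite -[pm_map M _ _]trE tr_comp.
by rewrite freemod_supp // !raddf0.
Defined.

Lemma unfreeE V M (phi : forall z, {linear V z -> M z}) y s :
  unfree phi y s = \sum_z tr y (phi z (val s z)).
Proof. by []. Qed.

Lemma single_supported V y (v : V y) :
  supported V y (@dfwith P V (fun=> 0) y v).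
Proof. by move=> z zy; rewrite dfwith_out //; apply: contra zy => /eqP ->. Qed.

Definition single V y (v : V y) : freemod V y := to_subsp (single_supported v).

Lemma unfree_single V M (phi : forall z, {linear V z -> M z}) y v :
  unfree phi y (single v) = phi y v.
Proof.
rewrite unfreeE (bigD1 y) //= dfwith_in tr_id big1 ?addr0 // => z zy.
by rewrite dfwith_out 1?eq_sym // !raddf0.
Qed.

(** A morphism out of a free module is determined by its values on generators,
    and these are lifted by linear sections. *)
Lemma freemod_projective V : pm_projective (freemod V).
Proof.
move=> A B p f p_epi.
have [g pg] : {g : forall z, {linear B z -> A z} |
    forall z w, p z (g z w) = w}.
  have sec z := cid (linear_section (p_epi z)).
  by exists (fun z => sval (sec z)) => z; apply: svalP (sec z).
pose h y (s : freemod V y) : A y := \sum_(z | z <= y) tr y (g z (f z (cut (pred1 z) z s))).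
have h_lin y : linear (h y).
  move=> a s t; rewrite /h scaler_sumr -big_split; apply: eq_bigr => z _ /=.
  by rewrite !linearP.
unshelve eexists (@PMHom _ _ P (freemod V) A (fun y => mklin (@h_lin y)) _).
  move=> x y xy s; rewrite -!trE.
  change (h y (tr y s) = tr y (h x s)); rewrite /h raddf_sum.
  rewrite [RHS](eq_bigr (fun z => tr y (g z (f z (cut (pred1 z) z s))))); last first.
    by move=> z zx; rewrite /= tr_comp.
  rewrite big_mkcond [RHS]big_mkcond; apply: eq_bigr => z _.
  rewrite cut_tr //; have [zx|zx] := boolP (z <= x).
    by rewrite (le_trans zx).
  case: ifP => // _; suff -> : cut (pred1 z) z s = 0 by rewrite !raddf0.
  apply: freemodE => t; rewrite val_cut freemod0 /=; case: eqP => //= ->.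
  by rewrite lexx freemod_supp.
move=> y s; rewrite /= /h raddf_sum.
rewrite (eq_bigr (fun z => f y (tr y (cut (pred1 z) z s)))); last first.
  by move=> z _; rewrite /= !tr_hom pg.
rewrite -raddf_sum; congr (f y _); apply: freemodE => t.
have valD : {morph (fun u : freemod V y => val u t) : u v / u + v >-> u + v} by [].
rewrite (big_morph _ valD (freemod0 _ _ _)).
have [ty|ty] := boolP (t <= y); last first.
  rewrite [RHS]freemod_supp // big1 // => z zy; rewrite val_tr // val_cut /=.
  by case: eqP => //= tz; move: ty; rewrite tz zy.
rewrite (bigD1 t) //= val_tr // val_cut /= eqxx lexx big1 ?addr0 // => z /andP[zy zt].
by rewrite val_tr // val_cut /= eq_sym (negPf zt).
Qed.

Definition cover M : pm_hom (freemod M) M := unfree (fun z => idfun : {linear M z -> M z}).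

Lemma cover_epi M : pm_epi (cover M).
Proof. by move=> y m; exists (single m); apply: unfree_single. Qed.

(** A projective module is a retract of its free cover. *)
Lemma projective_exact M l y j : pm_projective M -> exact_at M l y j.
Proof.
move=> M_proj.
pose id_M := @PMHom _ _ P M M (fun x => idfun) (fun _ _ _ _ => erefl).
have [g coverK] := M_proj _ _ (cover M) id_M (@cover_epi M).
exact: exact_at_retract coverK (@freemod_exact _ _ _ _).
Qed.

End Free.

(** * Modules acyclic above degree 0 are projective *)

Section Acyclic.
Context {K : fieldType} {d : Order.disp_t} {P : finLatticeType d}.
Local Open Scope order_scope.
Implicit Types (M N : pmod K P) (l : seq P) (x y z a b : P).

(** In a distributive lattice this condition makes the cube strongly
    bicartesian. *)
Definition coindep y l : bool := pairwise (fun a b => y <= a `|` b) l.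

Definition acyclic m M : Prop :=
  forall l y j, coindep y l -> (m <= j)%N -> exact_at M l y j.

(** The component at the terminal vertex, which is all of degree 0. *)
Fixpoint topc M l : forall y, chains M l y -> M y :=
  match l return forall y, chains M l y -> M y with
  | [::] => fun y m => m
  | b :: l' => fun y c => topc c.1
  end.

Lemma topcB M l y (u v : chains M l y) : topc (u - v) = topc u - topc v.
Proof. by elim: l y u v => [|b l IH] y u v //=; rewrite -IH. Qed.

Lemma topc_cmap M N (g : forall x y, {linear M x -> N y}) l x y
  (c : chains M l x) : topc (cmap g y c) = g x y (topc c).
Proof. by elim: l x y c => [|b l IH] x y c //=. Qed.

Lemma topc_inj M l y (c : chains M l y) : homog 0 c -> topc c = 0 -> c = 0.
Proof.
elim: l y c => [|b l IH] y c //=; case: c => u v /= [hu ->] /(IH _ _ hu) ->.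
by [].
Qed.

Lemma topc_surj M l y (m : M y) : exists c : chains M l y, homog 0 c /\ topc c = m.
Proof.
elim: l => [|b l [c [hc cm]]]; first by exists m; split; [left|].
by exists (c, 0).
Qed.

(** The sum of the images of the [M (y `&` b)] in [M y]. By the next two lemmas
    it is the image of the boundary from degree 1. *)
Fixpoint sums M l y : M y -> Prop :=
  if l is b :: l' then
    fun m => exists (u : M (y `&` b)) m', sums l' m' /\ m = tr y u + m'
  else fun m => m = 0.

Lemma sumsN M l y (m : M y) : sums l m -> sums l (- m).
Proof.
elim: l m => [|b l IH] m /=; first by move=> ->; rewrite oppr0.
by move=> [u [m' [/IH sm' ->]]]; exists (- u), (- m'); rewrite opprD raddfN.
Qed.

Lemma sums_bd M l y (c : chains M l y) : homog 1 c -> sums l (topc (bd c)).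
Proof.
elim: l y c => [|b l IH] y c //=; case: c => v u /= [hv hu].
exists (topc u), (- topc (bd v)); split; first exact/sumsN/IH.
by rewrite topcB topc_cmap.
Qed.

Lemma bd_sums M l y (m : M y) : sums l m ->
  exists c : chains M l y, homog 1 c /\ topc (bd c) = m.
Proof.
elim: l m => [|b l IH] m /=; first by move=> ->; exists 0; split; [right|].
move=> [u [m' [sm' ->]]]; have [v [hv dv]] := IH _ (sumsN sm').
have [c [hc cu]] := topc_surj l u.
by exists (v, c); rewrite /= topcB topc_cmap dv cu opprK.
Qed.

(** The only consequence of exactness in degree 1 used below: a chain that
    combines [m] with an expression of its image as an element of [sums l] is a
    cycle, and a chain bounding it expresses [m] itself. *)
Lemma acyclic_sums M b l y (m : M (y `&` b)) : acyclic 0 M ->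
  coindep y (b :: l) -> sums l (tr y m) -> sums l m.
Proof.
move=> M0 ci sm; have [v [hv dv]] := bd_sums sm.
have [u [hu um]] := topc_surj l m.
have [||[v' u'] /= [[_ hu'] [_ du']]] := M0 (b :: l) y 0%N ci (leqnn _) (v, u).
- by [].
- rewrite /= (bd_homog0 hu) [X in (X, _)](_ : _ = 0) //; apply: topc_inj.
    by apply: homogB; [apply: cmap_homog|apply: bd_homog].
  by rewrite topcB topc_cmap dv um subrr.
by rewrite -um -du'; apply: sums_bd.
Qed.

(** Generators of [M] are chosen as complements [W y] of the part of [M y] that
    comes from below. The free module on them maps onto [M] for any [M], and
    injectively if [M] is acyclic above 0. *)
Section FreeBasis.
Variable M : pmod K P.
Hypothesis M0 : acyclic 0 M.

Definition from_below_fun y (t : dprod (fun x => M x)) : M y :=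
  \sum_(x | x < y) tr y (t x).

Lemma from_below_linear y : linear (@from_below_fun y).
Proof.
move=> c s t; rewrite /from_below_fun scaler_sumr -big_split; apply: eq_bigr => x _ /=.
by rewrite -[(c *: s + t) x]/(c *: s x + t x) linearP.
Qed.

HB.instance Definition _ y :=
  GRing.isLinear.Build K (dprod (fun x => M x)) (M y) *:%R
    (@from_below_fun y) (@from_below_linear y).

Definition radical y : subspace (M y) := Defs.image (@from_below_fun y).

Variable W : forall y, subspace (M y).
Hypothesis WP : forall y, compl (radical y) (W y).

Let V y : lmodType K := subsp (W y).
Let incl y : {linear V y -> M y} :=
  mklin ((fun _ _ _ => erefl) : linear (fun v : V y => val v)).
Let Phi : pm_hom (freemod V) M := unfree incl.

Let PhiD y (s t : freemod V y) : Phi y (s + t) = Phi y s + Phi y t.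
Proof. exact: (raddfD (Phi y)). Qed.

Let PhiB y (s t : freemod V y) : Phi y (s - t) = Phi y s - Phi y t.
Proof. exact: (raddfB (Phi y)). Qed.

Let Phi_tr x y (s : freemod V x) : Phi y (tr y s) = tr y (Phi x s).
Proof. exact: tr_hom. Qed.

Let Phi_epi : pm_epi Phi.
Proof.
move=> y; have [n] := ubnP #|[set x : P | x < y]|; elim: n y => // n IH y yn m.
have [_ [w [[t <-] Ww ->]]] := (WP y).2 m.
have step x : x < y -> exists s, Phi x s = t x.
  move=> xy; apply: IH; rewrite -ltnS; apply: leq_trans yn; rewrite ltnS.
  apply/proper_card/properP; split.
    by apply/subsetP => z; rewrite !inE => /lt_trans; apply.
  by exists x; rewrite !inE ?ltxx.
have [s sP] : exists s : forall x, freemod V x, forall x, x < y -> Phi x (s x) = t x.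
  have sx x : exists s, x < y -> Phi x s = t x.
    have [xy|] := boolP (x < y); last by exists 0.
    by have [s <-] := step x xy; exists s.
  by exists (fun x => sval (cid (sx x))) => x; case: cid.
exists (\sum_(x | x < y) tr y (s x) + single (to_subsp Ww)).
rewrite raddfD /= raddf_sum; congr (_ + _); last exact: (unfree_single incl).
by apply: eq_bigr => x xy; rewrite -sP //; exact: Phi_tr.
Qed.

Let below l y (s : freemod V y) : Prop :=
  forall z, val s z != 0 -> has (fun b => z <= b) l.

Let sums_Phi l y (s : freemod V y) : below l s -> sums l (Phi y s).
Proof.
elim: l s => [|b l IH] s sl /=.
  suff -> : s = 0 by rewrite raddf0.
  by apply: freemodE => z; apply/eqP/negPn/negP => /sl.
pose A := [pred z | z <= b]; pose u := cut A (y `&` b) s.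
exists (Phi _ u), (Phi y (s - tr y u)); split.
  apply: IH => z; rewrite freemodB val_tr ?leIl // val_cut /= lexI.
  have [zy|/freemod_supp ->] := boolP (z <= y); last by case: ifP; rewrite subr0 eqxx.
  have [zb|zb] := boolP (z <= b); first by rewrite subrr eqxx.
  by rewrite subr0 => /sl /=; rewrite (negPf zb).
by rewrite PhiB Phi_tr addrC subrK.
Qed.

Let Phi_sums l y (m : M y) : sums l m ->
  exists s : freemod V y, below l s /\ Phi y s = m.
Proof.
elim: l m => [|b l IH] m /=.
  by move=> ->; exists 0; rewrite raddf0; split=> // z; rewrite freemod0 eqxx.
move=> [u [m' [/IH[s [sl <-]] ->]]]; have [t <-] := Phi_epi u.
exists (tr y t + s); split; last by rewrite PhiD Phi_tr.
move=> z; have [zb|zb] := boolP (z <= b); first by rewrite /= zb.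
rewrite freemodD val_tr ?leIl // freemod_supp ?lexI ?(negPf zb) ?andbF // add0r.
by move=> /sl zl; rewrite /= zl orbT.
Qed.

(** By induction on [y]. The component in degree [y] of a relation vanishes by
    the choice of [W y]. The others lie below the elements covered by [y], any
    two of which join to [y]; these are removed one at a time. The part [u]
    below [b] but below no element of [l] has its image in the sum over [l], so
    by [acyclic_sums] this image also comes from a combination supported below
    [l]. By induction [u] equals that combination, so it has empty support. *)
Let Phi_inj y (s : freemod V y) : Phi y s = 0 -> s = 0.
Proof.
have [n] := ubnP #|[set x : P | x < y]|; elim: n y s => // n IH y s yn s0.
have Phi_inj_lt x (t t' : freemod V x) : x < y -> Phi x t = Phi x t' -> t = t'.
  move=> xy tt'; apply/eqP; rewrite -subr_eq0; apply/eqP/IH; last first.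
    by rewrite PhiB tt' subrr.
  rewrite -ltnS; apply: leq_trans yn; rewrite ltnS; apply/proper_card/properP; split.
    by apply/subsetP => z; rewrite !inE => /lt_trans; apply.
  by exists x; rewrite !inE ?ltxx.
have below0 l : coindep y l -> all (fun b => b < y) l ->
    forall t : freemod V y, below l t -> Phi y t = 0 -> t = 0.
  elim: l => [|b l IHl] ci ly t tl t0.
    by apply: freemodE => z; apply/eqP/negPn/negP => /tl.
  case/andP: ly => b_y ly; have byy : y `&` b < y.
    by rewrite lt_neqAle leIl andbT; apply: contraTneq b_y => <-; rewrite le_gtF ?leIr.
  pose A := [pred z | ~~ has (fun b => z <= b) l]; pose u := cut A (y `&` b) t.
  have tuE z : val (t - tr y u) z = if ~~ A z then val t z else 0.
    rewrite freemodB val_tr ?leIl // val_cut; have [Az|] := boolP (A z); last by rewrite subr0.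
    rewrite /=; case: ifPn => [_|zyb]; first by rewrite subrr.
    rewrite subr0; apply/eqP/negPn/negP => tz.
    have zy : z <= y by apply: contraNT tz => /freemod_supp ->.
    have := tl z tz; rewrite /= (negPf Az) orbF => zb.
    by rewrite lexI zy zb in zyb.
  have tul : below l (t - tr y u).
    by move=> z; rewrite tuE /= negbK; case: ifP => //; rewrite eqxx.
  have u0 : u = 0.
    have su : sums l (Phi _ u).
      apply: (acyclic_sums M0 ci); rewrite -Phi_tr.
      have -> : Phi y (tr y u) = - Phi y (t - tr y u).
        by rewrite PhiB t0 sub0r opprK.
      exact/sumsN/sums_Phi.
    have [t' [t'l ut']] := Phi_sums su.
    have ut := Phi_inj_lt _ _ _ byy ut'; rewrite -ut.
    apply: freemodE => z; rewrite freemod0; apply/eqP/negPn/negP => /[dup] /t'l zl.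
    by rewrite ut val_cut /= zl /= eqxx.
  apply: IHl => //; first by case/andP: ci.
  by move: tul; rewrite u0 raddf0 subr0.
(* the elements covered by [y] *)
pose l := [seq b <- enum P | (b < y) && [forall x, (b < x) ==> ~~ (x < y)]].
have s_y : val s y = 0.
  apply: val_inj; apply: (WP y).1; last exact: subsp_valP.
  exists (fun z => - incl z (val s z)); apply/esym/eqP; rewrite /= /from_below_fun.
  rewrite -subr_eq0; move/eqP: s0.
  rewrite unfreeE (bigD1 y) //= tr_id; apply: etrans; congr (_ == 0); congr (_ + _).
  rewrite -sumrN [RHS](bigID (fun z => z <= y)) /= [X in _ = _ + X]big1 ?addr0.
    rewrite [RHS](eq_bigl (fun z => z < y)) => [|z]; last by rewrite lt_neqAle.
    by apply: eq_bigr => z _; rewrite raddfN opprK.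
  by move=> z /andP[_ zy]; rewrite [subsp_val s z]freemod_supp // !raddf0.
apply: (below0 l) => //.
- rewrite /coindep; have : uniq l by rewrite filter_uniq ?enum_uniq.
  have : all [pred b | (b < y) && [forall x, (b < x) ==> ~~ (x < y)]] l.
    exact: filter_all.
  elim: l => //= b l IHl /andP[/andP[b_y bmax] ly] /andP[bl lu].
  rewrite IHl // andbT; apply/allP => b' b'l.
  have /andP[b'_y b'max] := allP ly _ b'l.
  have : b `|` b' <= y by rewrite leUx !ltW.
  rewrite le_eqVlt => /orP[/eqP <- //|bb'y].
  have bb' : b == b `|` b'.
    have := implyP (forallP bmax (b `|` b')); rewrite bb'y lt_neqAle leUl andbT.
    by move=> H; apply: contraT => /H.
  have b'b : b' == b `|` b'.
    have := implyP (forallP b'max (b `|` b')); rewrite bb'y lt_neqAle leUr andbT.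
    by move=> H; apply: contraT => /H.
  by move: bl; rewrite (eqP bb') -(eqP b'b) b'l.
- by apply/allP => b; rewrite mem_filter => /andP[/andP[]].
move=> z sz; have zy : z < y.
  rewrite lt_neqAle; apply/andP; split; first by apply: contraNneq sz => ->; apply/eqP.
  by apply: contraNT sz => /freemod_supp ->.
have zyz : (z < y) && (z <= z) by rewrite zy lexx.
have [b /andP[b_y zb] bmax] := @arg_maxnP P z
  [pred b | (b < y) && (z <= b)] (fun b => #|[set x : P | x <= b]|) zyz.
apply/hasP; exists b => //; rewrite mem_filter mem_enum b_y !andbT.
apply/forallP => x; apply/implyP => bx; apply/negP => xy.
have := bmax x; rewrite /= xy (le_trans zb (ltW bx)) => /(_ isT).
rewrite leqNgt => /negP; apply; apply/proper_card/properP; split.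
  by apply/subsetP => t; rewrite !inE => /le_trans; apply; apply: ltW.
by exists x; rewrite !inE ?lexx // lt_geF.
Qed.

Lemma freemod_basis_projective : pm_projective M.
Proof. exact: projective_iso Phi_inj Phi_epi (@freemod_projective _ _ _ _). Qed.

End FreeBasis.

Lemma acyclic0_projective M : acyclic 0 M -> pm_projective M.
Proof.
move=> M0; have W y := cid (complement_exists (radical M y)).
exact: (freemod_basis_projective M0 (fun y => svalP (W y))).
Qed.

End Acyclic.

(** * Projective dimension and acyclicity *)

Section ProjectiveDimension.
Context {K : fieldType} {d : Order.disp_t} {P : finLatticeType d}.
Local Open Scope order_scope.
Implicit Types (M N : pmod K P).

Definition hom_comp L M N (g : pm_hom M N) (f : pm_hom L M) : pm_hom L N.
Proof.
by apply: (@PMHom _ _ P L N (fun x => g x \o f x)) => x y xy v /=; rewrite !pm_nat.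
Defined.

Definition pm_null : pmod K P.
Proof. by apply: (@PMod _ _ P (fun=> 'rV[K]_0) (fun _ _ _ => idfun)). Defined.

Definition hom_null M N : pm_hom M N.
Proof. by apply: (@PMHom _ _ P M N (fun x => \0)) => x y xy v; rewrite /= raddf0. Defined.

Lemma pm_null_zero : pm_zero pm_null.
Proof. by move=> x v; apply/rowP => -[]. Qed.

(** The image of the first differential is a syzygy with a resolution shorter
    by one. *)
Lemma pdim_le_acyclic m M : pdim_le m M -> acyclic m M.
Proof.
elim: m M => [|m IH] M [Q [del [aug [Q_proj Q_zero aug_epi ex0 exS]]]] l y j ci mj.
  have aug_inj x v : aug x v = 0 -> v = 0.
    by move=> /ex0[u <-]; rewrite (Q_zero 1%N _ _ u) // raddf0.
  have [g [_ augK]] := pm_inverse aug_inj aug_epi.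
  exact: exact_at_retract augK (projective_exact (Q_proj 0%N _)).
case: j mj => // j mj.
apply: (exact_at_quotient (f := pm_im_incl (del 0%N)) (g := aug)) => //.
- exact: pm_im_incl_inj.
- move=> x v; split=> [/ex0[u <-]|[[u uim] <-]].
    by exists (pm_to_im (del 0%N) x u).
  exact/ex0/(subsp_valP (Subsp uim)).
- exact/projective_exact/Q_proj.
apply: (IH (pm_im (del 0%N))) => //.
exists (fun i => Q i.+1), (fun i => del i.+1), (pm_to_im (del 0%N)); split=> //.
- by move=> i im; apply: Q_proj.
- by move=> i im; apply: Q_zero.
- exact: pm_to_im_epi.
- move=> x v; split=> [/(congr1 val) /= /exS //|/exS v0].
  exact: val_inj.
Qed.

(** Splice the free cover of [M] with a resolution of its kernel, which is
    acyclic one degree further down. *)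
Lemma acyclic_pdim_le m M : acyclic m M -> pdim_le m M.
Proof.
elim: m M => [|m IH] M Mm.
  exists (fun i => if i is 0%N then M else pm_null).
  exists (fun i => hom_null _ _), (@PMHom _ _ P M M (fun x => idfun) (fun _ _ _ _ => erefl)).
  split.
  - by case=> // _; apply: acyclic0_projective.
  - by case=> // i _; apply: pm_null_zero.
  - by move=> x v; exists v.
  - by move=> x v; split=> [/= ->|[u <-]] //; exists 0.
  - by move=> i x v; split=> // _; exists 0; rewrite (pm_null_zero v).
have [|Q [del [aug [Q_proj Q_zero aug_epi ex0 exS]]]] := IH (pm_ker (cover M)).
  move=> l y j ci mj.
  apply: (exact_at_kernel (@pm_ker_incl_inj _ _ _ _ _ (cover M))
    (@pm_ker_incl_exact _ _ _ _ _ (cover M))).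
  - exact: cover_epi.
  - exact: freemod_exact.
  - exact: Mm.
pose Q' i := if i is i'.+1 then Q i' else freemod M.
pose del' i : pm_hom (Q' i.+1) (Q' i) :=
  match i return pm_hom (Q' i.+1) (Q' i) with
  | 0%N => hom_comp (pm_ker_incl (cover M)) aug
  | i'.+1 => del i'
  end.
exists Q', del', (cover M); split.
- by case=> [_|i im]; [apply: freemod_projective|apply: Q_proj].
- by case=> [//|i im]; apply: Q_zero.
- exact: cover_epi.
- move=> x v; rewrite (pm_ker_incl_exact (cover M)); split=> [[u <-]|[u <-]].
    by have [w <-] := aug_epi x u; exists w.
  by exists (aug x u).
case=> [|i] x v; last exact: exS.
rewrite -ex0; split=> [v0|/= ->]; last by [].
exact: pm_ker_incl_inj v0.
Qed.

End ProjectiveDimension.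

(** * Total fibers *)

Section TotalFiberValue.
Context {K : fieldType}.

Lemma tr_pull d (P : porderType d) d' (Q : porderType d') (f : {omorphism Q -> P})
    (M : pmod K P) x y (v : M (f x)) : (x <= y)%O ->
  tr y (v : pm_pull f M x) = tr (f y) v.
Proof. by move=> xy; rewrite (trE xy) (trE (omorph_le f xy)). Qed.

(** Iterated kernels amount to a simultaneous kernel: the total fiber of a cube
    consists of the vectors at the initial vertex killed by the edges leaving it. *)
Lemma fiber_value k : exists nu : forall X, {linear ff_obj (fiber_rec K k) X -> X set0},
  [/\ forall X t, nu X t = 0 -> t = 0,
      forall X Y (f : pm_hom X Y) t, nu Y (ff_map (fiber_rec K k) f t) = f set0 (nu X t)
    & forall X v, (exists t, nu X t = v) <-> forall i, tr [set i] v = 0].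
Proof.
elim: k => [|k [nu [nu_inj nu_nat nuP]]].
  exists (fun X => mklin ((fun _ _ _ => erefl) :
    linear (fun t : ff_obj (fiber_rec K 0) X => val t))).
  split=> [X t t0|//|X v]; first exact: val_inj.
  split=> [[t <-] i|v0].
    by rewrite (ord1 i) (trE le_set01); apply: (subsp_valP t).
  have v0' : kernel (pm_map X le_set01) v by rewrite /= -trE v0.
  by exists (to_subsp v0').
pose G := fiber_rec K k.
have val_lin X : linear (fun t : ff_obj (fiber_rec K k.+1) X =>
    tr set0 (nu (front X) (val t) : X (front_set set0))).
  by move=> a s t; rewrite /= !linearP.
have front0 : (front_set (set0 : {set 'I_k.+1}) <= set0)%O by rewrite /front_set imset0.
have front0' : ((set0 : {set 'I_k.+2}) <= front_set (set0 : {set 'I_k.+1}))%O.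
  exact: sub0set.
have le0 (S : {set 'I_k.+2}) : (set0 <= S)%O := sub0set S.
have back0 : (back_set (set0 : {set 'I_k.+1}) <= [set ord_max])%O.
  by rewrite /back_set /front_set imset0 setU0.
have back0' : ([set ord_max] <= back_set (set0 : {set 'I_k.+1}))%O.
  by rewrite /back_set /front_set imset0 setU0.
have front1 j : (front_set [set j : 'I_k.+1] <= [set widen_ord (leqnSn _) j])%O.
  by rewrite /front_set imset_set1.
have front1' j : ([set widen_ord (leqnSn _) j] <= front_set [set j : 'I_k.+1])%O.
  by rewrite /front_set imset_set1.
have tr_front (X : pmod K {set 'I_k.+2}) S T (w : front X S) : (S <= T)%O ->
    tr T w = tr (front_set T) (w : X (front_set S)).
  exact: tr_pull.
have ker_last X t : ff_map G (front_back X) t = 0 <->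
    tr (back_set set0) (nu (front X) t : X (front_set set0)) = 0.
  rewrite (trE (front_back_le set0)) -[pm_map _ _ _]/(front_back X set0 (nu (front X) t)).
  rewrite -nu_nat; split=> [->|]; [exact: raddf0|exact: (nu_inj (back X))].
exists (fun X => mklin (@val_lin X)); split.
- move=> X t /= t0; apply: val_inj; apply: nu_inj.
  rewrite -[LHS](tr_id (M := X) (x := front_set set0)).
  by rewrite -(tr_comp (M := X) _ front0 front0') t0 raddf0.
- move=> X Y f t /=; rewrite tr_hom; congr (tr _ _).
  exact: (nu_nat _ _ (front_hom f)).
move=> X v; split=> [[t <-] i|v0].
  rewrite /= tr_comp ?le0 //.
  have [ik|ik] := ltnP i k.+1.
    have -> : i = widen_ord (leqnSn _) (Ordinal ik) by apply: val_inj.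
    rewrite -(tr_comp _ _ (front1 _)); last by apply/imsetS/sub0set.
    have /(nuP (front X)) t0 : exists t0, nu (front X) t0 = nu (front X) (val t).
      by exists (val t).
    have e := tr_front X set0 [set Ordinal ik] (nu (front X) (val t)) (sub0set _).
    by rewrite [X in tr _ X](etrans (esym e) (t0 _)) raddf0.
  have -> : i = ord_max by apply: val_inj; apply/eqP; rewrite eqn_leq ik -ltnS ltn_ord.
  rewrite -(tr_comp _ _ back0); last exact: front_back_le.
  have /ker_last -> := subsp_valP t; exact: raddf0.
have killed (j : 'I_k.+1) : tr (M := front X) [set j] (tr (front_set set0) v) = 0.
  apply: etrans (tr_front X set0 [set j] _ (sub0set _)) _.
  rewrite (tr_comp v front0'); last by apply/imsetS/sub0set.
  by rewrite -(tr_comp _ _ (front1' j)) ?le0 // v0 raddf0.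
have [w wv] := (nuP (front X) _).2 killed.
have w0 : kernel (ff_map G (front_back X)) w.
  apply/ker_last; rewrite wv tr_comp //; last exact: front_back_le.
  by rewrite -(tr_comp _ _ back0') ?le0 // v0 raddf0.
by exists (to_subsp w0); rewrite /= wv tr_comp // tr_id.
Qed.

Lemma tfib_eq0 k (X : pmod K {set 'I_k.+1}) :
  (forall t : tfib X, t = 0) <->
  (forall v : X set0, (forall i, tr [set i] v = 0) -> v = 0).
Proof.
have [nu [nu_inj _ nuP]] := fiber_value k; split=> [X0 v /nuP[t <-]|X0 t].
  by rewrite (X0 t) raddf0.
by apply: nu_inj; apply: X0; apply/nuP; exists t.
Qed.

End TotalFiberValue.

(** * The top degree of a cube *)

Section Corners.
Context {K : fieldType} {d : Order.disp_t} {P : finDistrLatticeType d}.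
Local Open Scope order_scope.
Implicit Types (M N : pmod K P) (l : seq P) (x y z a b : P).

Definition meets l y : P := foldl Order.meet y l.

Definition joins l y : P := foldl Order.join y l.

Definition del (T : Type) i (s : seq T) : seq T := take i s ++ drop i.+1 s.

Lemma le_meets l y z : (z <= meets l y) = (z <= y) && all (fun b => z <= b) l.
Proof.
by elim: l y => [|b l IH] y /=; rewrite ?andbT // IH lexI andbA.
Qed.

Lemma meets_le l y : meets l y <= y.
Proof. by have := lexx (meets l y); rewrite le_meets => /andP[]. Qed.

Lemma meets_le_all l y : all (fun b => meets l y <= b) l.
Proof. by have := lexx (meets l y); rewrite le_meets => /andP[]. Qed.

Lemma joins_le l y z : (joins l y <= z) = (y <= z) && all (fun b => b <= z) l.
Proof.
by elim: l y => [|b l IH] y /=; rewrite ?andbT // IH leUx andbA.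
Qed.

(** Distributivity: joining with [b] commutes with the meet. *)
Lemma le_meets_join l y z b : z <= y `|` b -> all (fun a => z <= a `|` b) l ->
  z <= meets l y `|` b.
Proof.
elim: l y => [|a l IH] y //= zy /andP[za zl].
by apply: IH => //; rewrite joinIl lexI zy.
Qed.

Lemma all_del (T : Type) (y : T) (p : pred T) i (s : seq T) : reflect
  (forall j, (j < size s)%N -> j != i -> p (nth y s j)) (all p (del i s)).
Proof.
apply: (iffP idP); elim: s i => [|x s IH] [|i]; rewrite /del //= ?drop0.
- by move=> /(all_nthP y) pl [|j] // jl _; apply: pl.
- by case/andP=> px /IH pl [|j] // jl ji; apply: pl.
- by move=> pl; apply/(all_nthP y) => j jl; apply: (pl j.+1).
move=> pl; rewrite (pl 0%N) //=; apply: IH => j jl ji; exact: (pl j.+1).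
Qed.

Lemma meets_del l y i : meets l y <= meets (del i l) y.
Proof.
rewrite le_meets meets_le; apply/(all_del y) => j jl _.
exact: (all_nthP y (meets_le_all l y)).
Qed.

Lemma coindep_nth y l : coindep y l -> forall i j, (i < size l)%N -> (j < size l)%N ->
  i != j -> y <= nth y l i `|` nth y l j.
Proof.
move=> /(pairwiseP y) ci i j il jl; rewrite neq_ltn => /orP[ij|ji]; first exact: ci.
by rewrite joinC; apply: ci.
Qed.

(** The component at the initial vertex, which is all of the top degree. *)
Fixpoint botc M l : forall y, chains M l y -> M (meets l y) :=
  match l return forall y, chains M l y -> M (meets l y) with
  | [::] => fun y m => m
  | b :: l' => fun y c => botc c.2
  end.

Lemma botc0 M l y : botc (0 : chains M l y) = 0.
Proof. by elim: l y => [|b l IH] y //=. Qed.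

Lemma botc_inj M l y (c : chains M l y) : homog (size l) c -> botc c = 0 -> c = 0.
Proof.
elim: l y c => [|b l IH] y c //=; case: c => v u /= [hv hu] u0.
by rewrite (IH _ _ hu u0) (homog_gt_size _ hv).
Qed.

Lemma botc_cmap M N (g : forall x y, {linear M x -> N y}) l x y
  (c : chains M l x) : botc (cmap g y c) = g (meets l x) (meets l y) (botc c).
Proof. by elim: l x y c => [|b l IH] x y c //=. Qed.

(** The edges leaving the initial vertex end at the meets with one entry left
    out, so these vectors form the total fiber; by [botc_surj] and [botc_bd]
    they are also the cycles of top degree. *)
Definition killed M l y (u : M (meets l y)) : Prop :=
  forall i, (i < size l)%N -> tr (meets (del i l) y) u = 0.

Lemma botc_surj M l y (u : M (meets l y)) : killed u ->
  exists c : chains M l y, [/\ homog (size l) c, bd c = 0 & botc c = u].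
Proof.
elim: l y u => [|b l IH] y u uk; first by exists u; split=> //; left.
have [|c [hc dc cu]] := IH (y `&` b) u.
  by move=> i il; apply: (uk i.+1).
exists (0, c); split=> //=; first by split=> //; apply: homog0.
rewrite dc raddf0 subr0 [X in (X, _)](_ : _ = 0) //.
apply: botc_inj; first exact: cmap_homog.
by rewrite botc_cmap cu; have := uk 0%N isT; rewrite /del /= drop0.
Qed.

Lemma botc_bd M l y (c : chains M l y) : homog (size l) c -> bd c = 0 -> killed (botc c).
Proof.
elim: l y c => [|b l IH] y c //=; case: c => v u /= [hv hu].
rewrite (homog_gt_size _ hv) // raddf0 subr0 => -[u0 du] [_|i il].
  by rewrite /del /= drop0 -botc_cmap u0 botc0.
exact: IH.
Qed.

Lemma acyclic_killed M m l y (u : M (meets l y)) :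
  acyclic m M -> coindep y l -> (m < size l)%N -> killed u -> u = 0.
Proof.
move=> Mm ci ml /botc_surj[c [hc dc <-]].
have [k lk] : exists k, size l = k.+1 by case: (size l) ml => // k; exists k.
rewrite lk in hc ml; have [e [he <-]] := Mm l y k ci ml c hc dc.
by rewrite (homog_gt_size _ he) ?lk // raddf0 botc0.
Qed.

(** Along a direction [b] above [y] the cube is constant, so the cone over it
    is contractible; the remaining directions preserve exactness. *)
Lemma degenerate_exact M l y j (c : chains M l y) :
  has (fun b => y <= b) l -> homog j c -> bd c = 0 ->
  exists e, homog j.+1 e /\ bd e = c.
Proof.
pose rho := @cmap K d P M M (fun x y => @tr K d P M x y).
elim: l y j c => [|b l IH] y j c //=; case: c => v u /= yl [hv hu] [dv du].
have {}dv : rho l _ y u = bd v by apply/eqP; rewrite -subr_eq0; apply/eqP.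
have [yb|nyb] := boolP (y <= b).
  have yy : y <= y `&` b by rewrite lexI lexx.
  exists (0, rho l _ (y `&` b) v); split; first by split; [apply: homog0|apply: cmap_homog].
  rewrite /= raddf0 subr0 -bd_rho // -dv !rho_comp ?leIl //.
  by rewrite !(cmap_id (g := fun x y => @tr K d P M x y)) // => *; apply: tr_id.
rewrite (negPf nyb) /= in yl.
have [u' [hu' du']] : exists u', homog j u' /\ bd u' = u.
  case: j hu {hv} => [->|j hu]; first by exists 0; rewrite raddf0; split=> //; apply: homog0.
  apply: IH => //; apply: sub_has yl => a; exact/le_trans/leIl.
have [||v' [hv' dv']] := IH y j (rho l _ y u' - v) yl.
- by apply: homogB => //; apply: cmap_homog.
- by rewrite raddfB /= -bd_rho ?leIl // du' -dv subrr.
by exists (v', u'); split=> //=; rewrite dv' du' subKr.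
Qed.

(** The endpoint [el i] of the [i]-th edge is below all entries but the [i]-th,
    so some chain separates it from the [i]-th entry. A chain that did so for
    two indices would contain a strictly increasing loop. *)
Lemma coindep_size n l y : embeds_in_chains (P := P) n -> coindep y l ->
  ~~ has (fun b => y <= b) l -> (size l <= n)%N.
Proof.
move=> [e [L [f fP]]] ci nd.
pose el (i : 'I_(size l)) := meets (del i l) y.
have el_b i : ~~ (el i <= nth y l i).
  apply: contra nd => eb; apply/(has_nthP y); exists i => //.
  apply: le_trans (_ : el i `|` nth y l i <= _); last by rewrite leUx eb lexx.
  apply: le_meets_join; first exact: leUl.
  by apply/(all_del y) => j jl ji; apply: coindep_nth.
have el_nth (i j : 'I_(size l)) : i != j -> el j <= nth y l i.
  move=> ij; have : el j <= el j by [].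
  by rewrite {2}/el le_meets => /andP[_ /(all_del y)]; apply.
have sep (i : 'I_(size l)) : exists t, (f t (nth y l i) < f t (el i)).
  apply: contrapT => nt; case/negP: (el_b i); apply/fP => t.
  by rewrite leNgt; apply/negP => lt; apply: nt; exists t.
pose t (i : 'I_(size l)) := sval (cid (sep i)).
have t_inj : injective t.
  move=> i j tij; apply/eqP/negPn/negP => ij.
  have := svalP (cid (sep i)); have := svalP (cid (sep j)).
  rewrite -/(t i) -/(t j) tij => ltj lti.
  have /fP/(_ (t j)) eij : el i <= nth y l j by apply: el_nth; rewrite eq_sym.
  have /fP/(_ (t j)) eji : el j <= nth y l i by apply: el_nth.
  have := lt_trans (lt_le_trans lti eij) (lt_le_trans ltj eji).
  by rewrite ltxx.
by have := leq_card _ t_inj; rewrite !card_ord.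
Qed.

Section Cube.
Variables (k : nat) (l : seq P) (y : P).
Hypotheses (lk : size l = k) (ci : coindep y l).

Definition list_cube_fun (S : {set 'I_k}) : P :=
  meets [seq nth y l i | i : 'I_k <- enum (~: S)] y.

Lemma le_list_cube z (S : {set 'I_k}) :
  reflect (z <= y /\ forall i, i \notin S -> z <= nth y l i)
  (z <= list_cube_fun S).
Proof.
rewrite le_meets; apply: (iffP andP) => -[zy zS]; split=> //.
  move=> i iS; apply: (allP zS); apply/map_f.
  by rewrite mem_enum inE.
by apply/allP => _ /mapP[i iS ->]; apply: zS; rewrite mem_enum inE in iS.
Qed.

Lemma list_cube_le : {homo list_cube_fun : S T / (S <= T)%O}.
Proof.
move=> S T ST; have /le_list_cube[Sy Sl] := lexx (list_cube_fun S).
by apply/le_list_cube; split=> // i iT; apply: Sl; apply: contra iT; apply: (subsetP ST).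
Qed.

HB.instance Definition _ :=
  Order.isOrderMorphism.Build _ _ _ _ list_cube_fun list_cube_le.

Definition list_cube : {omorphism {set 'I_k} -> P} := list_cube_fun.

Lemma list_cube_bicartesian : strongly_bicartesian list_cube.
Proof.
move=> S T; split; apply: le_anti; apply/andP; split.
- have /le_list_cube[Uy Ul] := lexx (list_cube_fun (S :|: T)).
  rewrite {2}/list_cube /= /list_cube_fun; apply: le_meets_join.
    exact: le_trans Uy (leUl _ _).
  apply/allP => _ /mapP[i iS ->]; rewrite mem_enum inE in iS.
  rewrite joinC; apply: le_meets_join; first exact: le_trans Uy (leUl _ _).
  apply/allP => _ /mapP[j jT ->]; rewrite mem_enum inE in jT.
  have [ij|ij] := eqVneq i j.
    by rewrite -ij joinxx; apply: Ul; rewrite inE negb_or iS ij.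
  apply: le_trans Uy _; apply: coindep_nth; rewrite ?lk //.
  by rewrite eq_sym.
- rewrite leUx; apply/andP; split; apply: list_cube_le.
    exact: subsetUl.
  exact: subsetUr.
- rewrite lexI; apply/andP; split; apply: list_cube_le.
    exact: subsetIl.
  exact: subsetIr.
have : list_cube S `&` list_cube T <= list_cube S by exact: leIl.
have : list_cube S `&` list_cube T <= list_cube T by exact: leIr.
move=> /le_list_cube[_ hT] /le_list_cube[hy hS]; apply/le_list_cube; split=> // i.
by rewrite inE negb_and => /orP[/hS|/hT].
Qed.

End Cube.

Definition corner_free k M : Prop := forall l y (u : M (meets l y)),
  size l = k -> coindep y l -> killed u -> u = 0.

Lemma meets_cube k (X : {omorphism {set 'I_k} -> P}) (s : seq 'I_k) A :
  strongly_bicartesian X ->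
  meets [seq X (~: [set i]) | i <- s] (X A) = X (A :&: ~: [set i in s]).
Proof.
move=> Xsb; elim: s A => [|i s IH] A /=.
  by congr (X _); apply/setP => j; rewrite !inE andbT.
rewrite -[X in meets _ X](Xsb _ _).2 IH; congr (X _).
by apply/setP => j; rewrite !inE negb_or andbA.
Qed.

Lemma map_del (T U : Type) (f : T -> U) (s : seq T) i :
  del i (map f s) = map f (del i s).
Proof. by rewrite /del -map_take -map_drop map_cat. Qed.

(** Strongly bicartesian cubes in [P] and coindependent lists describe the same
    data: [list_cube] in one direction, and in the other the values of a cube
    at the complements of points, whose meets [meets_cube] computes. *)
Lemma cross_degree_corner k M : cross_degree k M <-> corner_free k.+1 M.
Proof.
split=> [cdM l y u lk ci uk|cfM X Xsb].
  pose X := list_cube k.+1 l y.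
  have /tfib_eq0 X0 := cdM X (list_cube_bicartesian lk ci).
  have Xle : X set0 <= meets l y.
    have /le_list_cube[Xy Xl] := lexx (X set0).
    rewrite le_meets Xy; apply/(all_nthP y) => i; rewrite lk => il.
    by apply: (Xl (Ordinal il)); rewrite inE.
  have leX : meets l y <= X set0.
    apply/le_list_cube; split=> [|i _]; first exact: meets_le.
    by apply: (all_nthP y (meets_le_all l y)); rewrite lk.
  rewrite -[u]tr_id -(tr_comp _ leX Xle) (X0 (tr (X set0) u)) ?raddf0 // => i.
  have X0i : (set0 <= [set i])%O := sub0set _.
  rewrite (tr_pull (f := X)) // tr_comp //; last exact: omorph_le.
  rewrite -(tr_comp (y := meets (del i l) y)) ?uk ?raddf0 ?lk //.
    exact: meets_del.
  apply/le_list_cube; split=> [|j]; first exact: meets_le.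
  rewrite inE => ji; apply: (all_del y _ _ _ (meets_le_all (del i l) y)) => //.
  by rewrite lk.
have X0i i : ((set0 : {set 'I_k.+1}) <= [set i])%O := sub0set _.
apply/tfib_eq0 => v vk.
have {}vk i : tr (X [set i]) (v : M (X set0)) = 0 := etrans (esym (tr_pull v (X0i i))) (vk i).
move: (v : M (X set0)) vk => {}v vk; pose e := enum 'I_k.+1.
pose y := X setT; pose l := [seq X (~: [set i]) | i <- e].
have Xle : X set0 <= meets l y.
  by rewrite /l meets_cube //; apply/omorph_le/sub0set.
have leX : meets l y <= X set0.
  rewrite /l meets_cube //; apply/omorph_le/subsetP => i.
  by rewrite !inE mem_enum.
rewrite -[v]tr_id -(tr_comp _ Xle leX).
rewrite (cfM l y (tr (meets l y) v)) ?raddf0 //.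
- by rewrite size_map size_enum_ord.
- rewrite /coindep pairwise_map; apply: (sub_pairwise (r := fun i j => i != j)) => [i j ij|].
    rewrite /= -(Xsb _ _).1; apply/omorph_le/subsetP => h _.
    by rewrite !inE; case: eqP => // ->.
  by rewrite -uniq_pairwise enum_uniq.
move=> i; rewrite size_map => ie; pose j := nth ord0 e i.
have jW : X [set j] <= meets (del i l) y.
  rewrite map_del meets_cube //; apply/omorph_le/subsetP => h.
  rewrite !inE => /eqP ->; have /allP jdel : all (predC1 j) (del i e).
    by apply/(all_del ord0) => h' he hi; rewrite /= nth_uniq ?enum_uniq.
  by apply/negP => /jdel; rewrite /= eqxx.
rewrite tr_comp //; last exact: meets_del.
by rewrite -(tr_comp v (omorph_le X (X0i j)) jW) vk raddf0.
Qed.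

End Corners.

(** * Cross-degree and acyclicity *)

Section CrossDegreeAcyclic.
Context {K : fieldType} {d : Order.disp_t} {P : finDistrLatticeType d}.
Local Open Scope order_scope.
Implicit Types (M N : pmod K P) (l : seq P) (x y z a b : P).

(** A nondegenerate cube has at most [k.+1] directions, so degree [j.+1] with
    [k <= j] is either empty or the top degree of a cube with [k.+1]
    directions. *)
Lemma corner_free_acyclic k M :
  embeds_in_chains (P := P) k.+1 -> corner_free k.+1 M -> acyclic k M.
Proof.
move=> emb cf l y j ci kj c hc dc.
have [deg|nondeg] := boolP (has (fun b => y <= b) l); first exact: degenerate_exact.
have lk := coindep_size emb ci nondeg.
suff -> : c = 0 by exists 0; rewrite raddf0; split=> //; apply: homog0.
have [lj|jl] := ltnP (size l) j.+1; first exact: homog_gt_size hc.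
have lj : size l = j.+1 by apply/eqP; rewrite eqn_leq jl (leq_trans lk).
have jk : j = k by apply/eqP; rewrite eqn_leq kj -ltnS -lj lk.
rewrite -lj in hc; apply: botc_inj => //; apply: cf => //; first by rewrite lj jk.
exact: botc_bd.
Qed.

Lemma acyclic_corner_free k m M : acyclic k M -> (k < m)%N -> corner_free m M.
Proof. by move=> Mk km l y u lm ci; apply: acyclic_killed Mk ci _; rewrite lm. Qed.

End CrossDegreeAcyclic.

(** * Meet-dimension and the module Gamma *)

Section Separation.
Context {K : fieldType} {d : Order.disp_t} {P : finDistrLatticeType d}.
Local Open Scope order_scope.
Implicit Types (M N : pmod K P) (l s : seq P) (x y z v m : P).

Definition separated k M : Prop := forall x (u : M x),
  (forall v, x <= v -> (mdim v <= k)%N -> tr v u = 0) -> u = 0.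

(** Submodules of [T_pm] are separated, since the component at [v] of a
    compatible family on the elements above [x] is its image at [v] evaluated
    at [v] itself. *)
Lemma Gamma_iso_separated k M : pm_iso M (Gamma k M) <-> separated k M.
Proof.
split=> [[f [g [gf _]]] x u u0|Msep].
  suff fu0 : f x u = 0 by rewrite -[u]gf fu0 raddf0.
  apply: val_inj; apply: val_inj; apply: functional_extensionality_dep => -[v vP].
  have /andP[xv vk] := vP.
  have fv0 : pm_map (Gamma k M) xv (f x u) = 0.
    by rewrite -pm_nat -trE u0 // raddf0.
  have vv : (v <= v) && (mdim v <= k)%N by rewrite lexx.
  have vE : exist _ v vP = above_incl xv (exist _ v vv) by apply: val_inj.
  rewrite vE.
  exact: (congr1 (fun t : Gamma k M v => val (val t) (exist _ v vv)) fv0).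
have eta_inj x (u : M x) : Defs.eta k M x u = 0 -> u = 0.
  move=> e0; apply: Msep => w xw wk.
  have wP : (x <= w) && (mdim w <= k)%N by rewrite xw.
  have := congr1 (fun t : T_pm k M x => val t (exist _ w wP)) e0.
  by rewrite /= -trE.
have [|g [gf fg]] := pm_inverse (f := pm_to_im (Defs.eta k M)) _ (@pm_to_im_epi _ _ _ _ _ _).
  by move=> x u /(congr1 val); apply: eta_inj.
by exists (pm_to_im (Defs.eta k M)), g.
Qed.

Lemma meet_irreducible_prime m x y :
  meet_irreducible m -> x `&` y <= m -> (x <= m) || (y <= m).
Proof.
move=> /forallP mi xym; apply: contraT; rewrite negb_or => /andP[xm ym].
have lt z : ~~ (z <= m) -> m < m `|` z.
  by rewrite lt_neqAle leUl andbT eq_sym; apply: contra => /eqP <-; apply: leUr.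
have := implyP (forallP (mi (m `|` x)) (m `|` y)).
rewrite !lt // => /(_ isT) /eqP; rewrite -joinIr => e; case: e.
by rewrite join_l.
Qed.

Lemma mdimP v : ~~ maximal v -> exists s, [/\ size s = mdim v,
  all meet_irreducible s, is_meet v s &
  forall s', all meet_irreducible s' -> is_meet v s' -> (mdim v <= size s')%N].
Proof.
rewrite /mdim => /negPf ->; case: ex_minnP => k /existsP[s /andP[sm vs]] kmin.
exists s; split=> //; first exact: size_tuple.
move=> s' s'm vs'; apply: kmin; apply/existsP; exists (in_tuple s').
by rewrite s'm.
Qed.

(** If no [X [set i]] lies below [v], each [i] is witnessed by one of the at
    most [k] meet-irreducibles with meet [v]. Two of the [k.+1] indices share a
    witness, which is impossible for a meet-prime element above
    [X [set i] `&` X [set j]]. *)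
Lemma separated_cross_degree k M : separated k M -> cross_degree k M.
Proof.
move=> Msep X Xsb; have X0i i : ((set0 : {set 'I_k.+1}) <= [set i])%O := sub0set _.
apply/tfib_eq0 => u uk.
have {}uk i : tr (X [set i]) (u : M (X set0)) = 0 := etrans (esym (tr_pull u (X0i i))) (uk i).
move: (u : M (X set0)) uk => {}u uk; apply: Msep => v Xv vk.
suff [i iv] : exists i, X [set i] <= v.
  by rewrite -(tr_comp _ (omorph_le X (X0i i)) iv) uk raddf0.
have [vmax|/mdimP[s [sv sm /forallP vs _]]] := boolP (maximal v).
  exists ord0; have := forallP vmax (v `|` X [set ord0]).
  rewrite lt_neqAle leUl andbT negbK => /eqP ->; exact: leUr.
apply: contrapT => nv.
have sep (i : 'I_k.+1) : exists2 j : 'I_(size s), true & ~~ (X [set i] <= nth v s j).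
  have : ~~ all (fun m => X [set i] <= m) s.
    by rewrite -(eqP (vs _)); apply/negP => iv; apply: nv; exists i.
  rewrite -has_predC => /(has_nthP v)[j js /= ij].
  by exists (Ordinal js).
pose t i := s2val (cid2 (sep i)).
have t_inj : injective t.
  move=> i j tij; apply/eqP/negPn/negP => ij.
  have := s2valP' (cid2 (sep i)); have := s2valP' (cid2 (sep j)).
  rewrite -/(t i) -/(t j) tij => /negPf jt /negPf it.
  have mt : meet_irreducible (nth v s (t j)) by apply: (allP sm); apply: mem_nth.
  have vt : v <= nth v s (t j).
    by have := vs v; rewrite lexx => /eqP/esym/allP; apply; apply: mem_nth.
  have := meet_irreducible_prime (x := X [set i]) (y := X [set j]) mt.
  rewrite it jt -(Xsb _ _).2 => /= H; suff : false by []; apply: H.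
  apply: le_trans (le_trans Xv vt); apply/omorph_le/subsetP => h.
  by rewrite !inE => /andP[/eqP -> /eqP ji]; rewrite ji eqxx in ij.
have := leq_card _ t_inj; rewrite !card_ord sv => kv.
by have := leq_trans kv vk; rewrite ltnn.
Qed.

Lemma pairwise_count_le1 (T : Type) (p : pred T) (s : seq T) :
  (count p s <= 1)%N -> pairwise (fun a b => ~~ (p a && p b)) s.
Proof.
elim: s => //= a s IH; case: (p a) => /=.
  rewrite add1n ltnS leqn0 => /eqP s0; rewrite IH ?s0 // andbT.
  have : ~~ has p s by rewrite has_count s0.
  by rewrite -all_predC.
rewrite add0n => /IH ->; rewrite andbT; exact: all_predT.
Qed.

(** For [x] of meet-dimension above [k], a minimal expression [s] as a meet of
    meet-irreducibles and the join [y] of all elements below all but at most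
    one entry of [s] form a cube with initial vertex [x]. Minimality makes the
    edges at [x] proper, so induction shows that the vector dies along each of
    them. *)
Lemma corner_free_separated k M :
  (forall j, (k < j)%N -> corner_free j M) -> separated k M.
Proof.
move=> cf x; have [n] := ubnP #|[set z : P | x < z]|; elim: n x => // n IH x xn u uk.
have [xk|kx] := leqP (mdim x) k; first by rewrite -[u]tr_id uk.
have /mdimP[s [sx sm xs smin]] : ~~ maximal x.
  by apply/negP => xmax; rewrite /mdim xmax in kx.
have xsP z : (z <= x) = all (fun m => z <= m) s by apply/eqP/(forallP xs).
pose outside z m := ~~ (z <= m).
pose zs := [seq z <- enum P | (count (outside z) s <= 1)%N].
pose y := joins zs x.
have zsy z : (count (outside z) s <= 1)%N -> z <= y.
  move=> zc; have := lexx y; rewrite joins_le => /andP[_ /allP]; apply.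
  by rewrite mem_filter zc mem_enum.
have xy : x <= y by have := lexx y; rewrite joins_le => /andP[].
have xs_le : all (fun m => x <= m) s by rewrite -xsP.
have ci : coindep y s.
  apply/(pairwiseP x) => i j; rewrite !inE => is_ js ij.
  rewrite joins_le (le_trans (all_nthP x xs_le _ is_)) ?leUl //=.
  apply/allP => z; rewrite mem_filter => /andP[/pairwise_count_le1 zc _].
  have := pairwiseP x zc i j is_ js ij; rewrite negb_and !negbK => /orP[zi|zj].
    by rewrite (le_trans zi) ?leUl.
  by rewrite (le_trans zj) ?leUr.
have sx_le : meets s y <= x by rewrite xsP meets_le_all.
have x_le : x <= meets s y by rewrite le_meets xy.
rewrite -[u]tr_id -(tr_comp _ x_le sx_le).
rewrite (cf (size s) _ s y (tr (meets s y) u)) ?raddf0 //; first by rewrite sx.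
move=> i is_; rewrite tr_comp // ?meets_del //.
have xW : x <= meets (del i s) y := le_trans x_le (meets_del _ _ _).
have xW' : x < meets (del i s) y.
  rewrite lt_neqAle xW andbT; apply/negP => /eqP xE.
  have dm : all meet_irreducible (del i s).
    by apply/(all_del x) => j js _; apply: (all_nthP x sm).
  have sz : (size (del i s) < size s)%N.
    by rewrite size_cat size_take size_drop is_ -ltn_subRL subnS prednK ?subn_gt0.
  have [z zd zx] : exists2 z, all (fun m => z <= m) (del i s) & ~~ (z <= x).
    apply: contrapT => nz; have := smin _ dm; rewrite leqNgt -sx sz.
    suff xd : is_meet x (del i s) by move/(_ xd).
    apply/forallP => z; apply/eqP; apply/idP/idP => [zx|zd].
      by apply/(all_del x) => j js _; apply: (all_nthP x); rewrite -?xsP.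
    by apply: contrapT => /negP zx; apply: nz; exists z.
  case/negP: zx; rewrite xE le_meets zd andbT; apply: zsy.
  rewrite -(cat_take_drop i s) (drop_nth x) // count_cat /=.
  move: zd; rewrite all_cat => /andP[zt zr].
  have out0 r : all (fun m => z <= m) r -> count (outside z) r = 0%N.
    by elim: r => //= m r IHr /andP[zm /IHr ->]; rewrite /outside zm.
  by rewrite !out0 // add0n addn0 leq_b1.
apply: IH => [|v Wv vk].
  rewrite -ltnS; apply: leq_trans xn; rewrite ltnS; apply/proper_card/properP; split.
    by apply/subsetP => z; rewrite !inE; apply: lt_trans.
  by exists (meets (del i s) y); rewrite !inE ?ltxx.
by rewrite tr_comp // uk // (le_trans xW).
Qed.

End Separation.

(** * The equivalence *)

Theorem theorem5p15 (K : fieldType) (d : Order.disp_t)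
    (P : finDistrLatticeType d) (n : nat) (n_ge1 : (1 <= n)%N)
    (dimP : has_order_dim P n) (F : pmod K P) (fgF : fin_gen F) :
  (pdim_le n.-1 F <-> cross_degree n.-1 F) /\
  (cross_degree n.-1 F <-> pm_iso F (Gamma n.-1 F)).
Proof.
have [emb _] := dimP; rewrite -(prednK n_ge1) in emb.
move: n.-1 emb => k emb {n n_ge1 dimP fgF}.
have pdim_acyclic : pdim_le k F <-> acyclic k F.
  by split; [apply: pdim_le_acyclic|apply: acyclic_pdim_le].
have acyclic_cross : acyclic k F <-> cross_degree k F.
  rewrite cross_degree_corner; split; last exact: corner_free_acyclic.
  by move=> Fk; apply: acyclic_corner_free Fk _.
split; first by rewrite pdim_acyclic.
rewrite Gamma_iso_separated; split; last exact: separated_cross_degree.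
move=> /acyclic_cross Fk; apply: corner_free_separated => j kj.
exact: acyclic_corner_free Fk kj.
Qed.
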